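(* For all constants $a_1,a_2,a_3>0$ there exist constants $c_{\mathrm{sample}},c_{\mathrm{change}},c_{\mathrm{prob}}>0$, a decreasing function $c_{\mathrm{lower}}:[0,\infty)\to(0,\infty)$ and an increasing function $c_{\mathrm{upper}}:[0,\infty)\to(0,\infty)$, all depending only on $(a_1,a_2,a_3)$, such that the following holds for all integers $n,p\ge 2$ and $q\ge 1$. Let $X_1,\dots,X_n$ be i.i.d. random vectors in $\mathbb{R}^p$ such that (A1) $\mathbb{E}[(X_1^\top u)^2]\ge a_1$ for every $q$-sparse unit vector $u\in\mathbb{R}^p$; (A2) $\mathbb{E}[|X_1^\top u|^3]\le a_2$ for every $q$-sparse unit vector $u\in\mathbb{R}^p$; (A3) $|X_{1j}|\le a_3$ for each $j\in[p]$. If $n\ge c_{\mathrm{sample}}\cdot q^3\log(p)$, then with probability at least $1-\exp\{-c_{\mathrm{prob}}\cdot n/q^3\}$ the following two statements hold simultaneously for all $J\subseteq[p]$ with $|J|\le q$ and all $\beta,\beta'\in\mathbb{R}^J$: $$c_{\mathrm{lower}}(\|\beta\|_2)\,\mathbf{I}_J\preceq \tfrac1n H_J(\beta)\preceq c_{\mathrm{upper}}(\|\beta\|_2)\,\mathbf{I}_J$$ and $$\tfrac1n\|H_J(\beta)-H_J(\beta')\|\le c_{\mathrm{change}}\cdot\|\beta-\beta'\|_2 .$$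
   Context: $[p]=\{1,\dots,p\}$. A vector $u\in\mathbb{R}^p$ is $q$-sparse if it has at most $q$ nonzero coordinates; a unit vector has Euclidean norm $1$. Let $\mathrm{b}(\theta)=\log(1+e^\theta)$ (the logistic cumulant function), so $\mathrm{b}''(\theta)=e^\theta/(1+e^\theta)^2$. The negative Hessian of the logistic regression log-likelihood with covariates $X_1,\dots,X_n$ is $H(\beta)=\sum_{i=1}^n X_iX_i^\top\,\mathrm{b}''(X_i^\top\beta)\in\mathbb{R}^{p\times p}$ for $\beta\in\mathbb{R}^p$. For $J\subseteq[p]$, $\mathbb{R}^J$ denotes vectors indexed by $J$; a vector $\beta\in\mathbb{R}^J$ is identified with the vector in $\mathbb{R}^p$ obtained by filling in zeros outside $J$, and $H_J(\beta)$ is the $J\times J$ submatrix of $H(\beta)$. $\mathbf{I}_J$ is the $J\times J$ identity matrix, $\|\cdot\|$ is the spectral norm of a matrix, and $A\preceq B$ means that $B-A$ is positive semidefinite. *)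

(* Defs.v *)
From mathcomp Require Import all_boot all_order all_algebra.
From mathcomp Require Import all_classical all_reals all_analysis.
From mathcomp Require Import ring.
Set Implicit Arguments.
Unset Strict Implicit.
Unset Printing Implicit Defensive.
Import Order.TTheory GRing.Theory Num.Theory.
Import numFieldNormedType.Exports.

Local Open Scope classical_set_scope.
Local Open Scope ring_scope.

Section linear_algebra.
Context {R : realType}.

Definition dotv m (u v : 'cV[R]_m) : R := (u^T *m v) 0 0.

(* The library's norm on matrices is the sup norm. *)
Definition l2norm m (u : 'cV[R]_m) : R := Num.sqrt (\sum_i u i 0 ^+ 2).

Definition sparse m (q : nat) (u : 'cV[R]_m) : Prop :=
  (#|[pred j | (u j 0 != 0)%R]| <= q)%N.

Definition psd m (A : 'M[R]_m) : Prop :=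
  A^T = A /\ forall u : 'cV[R]_m, 0 <= dotv u (A *m u).

Definition loewner_le m (A B : 'M[R]_m) : Prop := psd (B - A).

(* The unit ball, rather than the unit sphere, keeps the set nonempty when
   m = 0. *)
Definition spectral_norm m (A : 'M[R]_m) : R :=
  sup [set l2norm (A *m u) | u in [set u : 'cV[R]_m | l2norm u <= 1]].

(* Vectors indexed by J are coordinatised by the enumeration of J. *)
Definition embed p (J : {set 'I_p}) (b : 'cV[R]_#|J|) : 'cV[R]_p :=
  \col_j \sum_(k < #|J| | enum_val k == j) b k 0.

Definition principal_submx p (J : {set 'I_p}) (A : 'M[R]_p) : 'M[R]_#|J| :=
  mxsub enum_val enum_val A.

Definition vec_of_tuple p (x : p.-tuple R) : 'cV[R]_p := \col_j tnth x j.

End linear_algebra.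

Section logistic.
Context {R : realType}.

Definition logistic_cumulant (t : R) : R := ln (1 + expR t).

(* X : 'I_n -> 'cV_p is one realisation of the n covariate vectors. *)
Definition neg_hessian n p (X : 'I_n -> 'cV[R]_p) (b : 'cV[R]_p) : 'M[R]_p :=
  \sum_(i < n) logistic_cumulant^`(2)%classic (dotv (X i) b) *: (X i *m (X i)^T).

Definition neg_hessian_sub n p (X : 'I_n -> 'cV[R]_p) (J : {set 'I_p})
    (b : 'cV[R]_#|J|) : 'M[R]_#|J| :=
  principal_submx J (neg_hessian X (embed b)).

Lemma is_derive_1DexpR (t : R) :
  is_derive t 1 (fun x : R => 1 + expR x) (expR t).
Proof.
have h := is_deriveD (is_derive_cst (1 : R) t 1) (is_derive_expR t).
by rewrite add0r in h.
Qed.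

Lemma derive1_logistic_cumulant :
  logistic_cumulant^`()%classic = fun t : R => expR t / (1 + expR t).
Proof.
apply/funext => t.
have p : 0 < 1 + expR t by rewrite addr_gt0// expR_gt0.
have h := is_derive_1DexpR t.
have hl := is_derive1_ln p.
rewrite (_ : logistic_cumulant = @ln R \o (fun x : R => 1 + expR x))//.
rewrite derive1_comp; [|by case: h|by case: hl].
by rewrite !derive1E !derive_val mulrC.
Qed.

Lemma derive2_logistic_cumulant (t : R) :
  logistic_cumulant^`(2)%classic t = expR t / (1 + expR t) ^+ 2.
Proof.
rewrite derive1nS derive1n1 derive1_logistic_cumulant derive1E.
have p : 1 + expR t != 0 by rewrite gt_eqF// addr_gt0// expR_gt0.
have h := is_derive_1DexpR t.
rewrite (_ : (fun _ => _) = expR * (fun x : R => (1 + expR x)^-1))//.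
rewrite deriveM; [|exact: derivable_expR|exact: derivableV].
rewrite deriveV// !derive_val /GRing.scale/=.
by field.
Qed.

End logistic.

Section probability.
Context d (T : measurableType d) (R : realType) (P : probability T R).

(* Mutual independence of a finite family: subfamilies are covered by taking
   some of the A i to be the whole space. *)
Definition mutually_independent d' (T' : measurableType d') (I : finType)
    (X : I -> {RV P >-> T'}) : Prop :=
  forall A : I -> set T', (forall i, measurable (A i)) ->
    P (\bigcap_i (X i @^-1` A i)) = (\prod_i P (X i @^-1` A i))%E.

Definition identically_distributed d' (T' : measurableType d') (I : Type)
    (X : I -> {RV P >-> T'}) : Prop :=
  forall (i j : I) (A : set T'), measurable A ->
    distribution P (X i) A = distribution P (X j) A.

Definition iid d' (T' : measurableType d') (I : finType)
    (X : I -> {RV P >-> T'}) : Prop :=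
  mutually_independent X /\ identically_distributed X.

(* P is only meaningful on measurable sets; for measurable Q this amounts to
   r <= P Q. *)
Definition with_prob_ge (r : R) (Q : T -> Prop) : Prop :=
  exists E : set T,
    [/\ measurable E, (forall w, E w -> Q w) & (r%:E <= P E)%E].

End probability.

(* Main.v *)
(* Everything reduces to bounding, uniformly over q-sparse unit u, the empirical
   second moment of X_i . u from below and its third absolute moment from above:
   b''(t) >= exp(-|t|) / 4 gives the lower Loewner bound, b'' <= 1/4 the upper
   one, and since b'' is 1-Lipschitz the change of the Hessian is a trilinear
   form in |X_i . u|, controlled by cubes through AM-GM.

   For one fixed u, |X_i . u| <= a3 sqrt q, and Chernoff's bound for nonnegative
   bounded variables of bounded mean fails with probability at most
   exp(- r n / q^2). A union bound over a grid with (p (2 m q + 1))^q points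
   costs exp(C q log p), which n >= C' q^3 log p absorbs. The passage from the
   grid to all sparse u is self-bounding: the rounding error is itself a short
   sparse vector, so the supremum of the cubic moment reappears with a factor
   below 1. *)
Require Import Defs.
From mathcomp Require Import all_boot all_order all_algebra.
From mathcomp Require Import all_classical all_reals all_analysis.
From mathcomp Require Import measurable_realfun.
From mathcomp Require Import ring lra.
Set Implicit Arguments.
Unset Strict Implicit.
Unset Printing Implicit Defensive.
Import Order.TTheory GRing.Theory Num.Theory.
Import numFieldNormedType.Exports.

Local Open Scope classical_set_scope.
Local Open Scope ring_scope.

(** * The logistic weight *)

Section logistic_weight.
Context {R : realType}.
Local Notation b2 := ((@logistic_cumulant R)^`(2)%classic).

(** [1 + e^t] is at most twice the larger of [1] and [e^t]; this settles the two signs of [t]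
    separately. *)
Lemma logistic_weight_ge (t : R) : expR (- `|t|) / 4 <= b2 t.
Proof.
rewrite derive2_logistic_cumulant.
have e0 := expR_gt0 t.
have [t0|t0] := leP 0 t.
  rewrite ger0_norm// expRN.
  have e1 : 1 <= expR t by rewrite -expR0 ler_expR.
  rewrite ler_pdivlMr ?exprn_gt0 ?addr_gt0//.
  rewrite mulrAC ler_pdivrMr// ler_pdivrMl//.
  rewrite -subr_ge0.
  have -> : expR t * (expR t * 4) - (1 + expR t) ^+ 2 =
    (expR t - 1) * (3 * expR t + 1) by ring.
  by apply: mulr_ge0; lra.
rewrite ltr0_norm// opprK.
have e1 : expR t <= 1 by rewrite -expR0 ler_expR ltW.
rewrite ler_wpM2l ?(ltW e0)// lef_pV2 ?posrE ?exprn_gt0 ?addr_gt0//.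
rewrite -subr_ge0 (_ : _ - _ = (1 - expR t) * (3 + expR t)); last by ring.
by apply: mulr_ge0; lra.
Qed.

Lemma logistic_weight_le (t : R) : b2 t <= 4^-1.
Proof.
rewrite derive2_logistic_cumulant.
have e0 := expR_gt0 t.
rewrite ler_pdivrMr ?exprn_gt0 ?addr_gt0// ler_pdivlMl//.
rewrite -subr_ge0 (_ : _ - _ = (1 - expR t) ^+ 2); last by ring.
exact: sqr_ge0.
Qed.

(** The increment is at most [(e^t - e^s) / e^t = 1 - e^(s - t) <= t - s]. *)
Lemma sigmoid_lip (s t : R) : s <= t ->
  0 <= expR t / (1 + expR t) - expR s / (1 + expR s) <= t - s.
Proof.
move=> st.
have es := expR_gt0 s; have et := expR_gt0 t.
have est : expR s <= expR t by rewrite ler_expR.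
have -> : expR t / (1 + expR t) - expR s / (1 + expR s) =
    (expR t - expR s) / ((1 + expR t) * (1 + expR s)).
  by field; rewrite !gt_eqF ?addr_gt0.
apply/andP; split.
  by rewrite divr_ge0 ?subr_ge0// mulr_ge0// addr_ge0// ltW.
apply: (@le_trans _ _ ((expR t - expR s) / expR t)).
  rewrite ler_wpM2l ?subr_ge0// lef_pV2 ?posrE ?mulr_gt0 ?addr_gt0//.
  by have := mulr_gt0 et es; lra.
rewrite mulrBl divff ?gt_eqF// -expRN -expRD.
have := expR_ge1Dx (s - t). lra.
Qed.

(* With sigma the sigmoid, b'' = sigma (1 - sigma), whose increments are those
   of sigma times the factor 1 - sigma s - sigma t of modulus at most one. *)
Lemma logistic_weight_lip (s t : R) : `|b2 s - b2 t| <= `|s - t|.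
Proof.
wlog st : s t / s <= t.
  move=> h; have [|/ltW] := leP s t; first exact: h.
  by rewrite distrC (distrC s); exact: h.
have sigmaE (x : R) :
    b2 x = (expR x / (1 + expR x)) * (1 - expR x / (1 + expR x)).
  rewrite derive2_logistic_cumulant; field.
  by rewrite gt_eqF// addr_gt0// expR_gt0.
have sigma_itv (x : R) : 0 <= expR x / (1 + expR x) <= 1.
  have ex := expR_gt0 x.
  rewrite divr_ge0 ?addr_ge0 ?(ltW ex)//=.
  by rewrite ler_pdivrMr ?addr_gt0// mul1r lerDr.
have /andP[h0 h1] := sigmoid_lip st.
rewrite !sigmaE.
have /andP[s0 s1] := sigma_itv s; have /andP[t0 t1] := sigma_itv t.
set x := expR s / _ in h0 h1 s0 s1 *; set y := expR t / _ in h0 h1 t0 t1 *.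
rewrite [`|s - t|]distrC [`|t - s|]ger0_norm ?subr_ge0//.
apply: le_trans h1.
have -> : x * (1 - x) - y * (1 - y) = (y - x) * (x + y - 1) by ring.
rewrite normrM (ger0_norm h0) ler_piMr// ler_norml; apply/andP; split; lra.
Qed.

End logistic_weight.

(** * Deterministic bounds on the Hessian *)

Section euclidean.
Context {R : realType}.

Lemma dotvE m (u v : 'cV[R]_m) : dotv u v = \sum_i u i 0 * v i 0.
Proof. by rewrite /dotv mxE; apply: eq_bigr => i _; rewrite mxE. Qed.

Lemma dotvC m (u v : 'cV[R]_m) : dotv u v = dotv v u.
Proof. by rewrite !dotvE; apply: eq_bigr => i _; rewrite mulrC. Qed.

Lemma dotvZr m (u v : 'cV[R]_m) c : dotv u (c *: v) = c * dotv u v.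
Proof. by rewrite /dotv -scalemxAr mxE. Qed.

Lemma dotvr0 m (u : 'cV[R]_m) : dotv u 0 = 0.
Proof. by rewrite -(scale0r 0) dotvZr mul0r. Qed.

Lemma dotvBr m (u v w : 'cV[R]_m) : dotv u (v - w) = dotv u v - dotv u w.
Proof. by rewrite /dotv mulmxBr !mxE. Qed.

Lemma l2norm_ge0 m (u : 'cV[R]_m) : 0 <= l2norm u.
Proof. exact: sqrtr_ge0. Qed.

Lemma sqr_l2norm m (u : 'cV[R]_m) : l2norm u ^+ 2 = \sum_i u i 0 ^+ 2.
Proof. by rewrite sqr_sqrtr// sumr_ge0// => i _; rewrite sqr_ge0. Qed.

Lemma l2norm_dotv m (u : 'cV[R]_m) : l2norm u ^+ 2 = dotv u u.
Proof. by rewrite sqr_l2norm dotvE; apply: eq_bigr => i _. Qed.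

Lemma l2normZ m (u : 'cV[R]_m) c : l2norm (c *: u) = `|c| * l2norm u.
Proof.
rewrite /l2norm (eq_bigr (fun i => c ^+ 2 * u i 0 ^+ 2)); last first.
  by move=> i _; rewrite mxE exprMn.
by rewrite -mulr_sumr sqrtrM ?sqr_ge0// sqrtr_sqr.
Qed.

Lemma l2norm0_eq0 m (u : 'cV[R]_m) : l2norm u = 0 -> u = 0.
Proof.
move=> u0; have := sqr_l2norm u; rewrite u0 expr0n/= => /esym/eqP.
rewrite psumr_eq0; last by move=> i _; rewrite sqr_ge0.
move=> /allP h; apply/matrixP => i j; rewrite mxE (ord1 j); apply/eqP.
by rewrite -sqrf_eq0; apply: h; rewrite mem_index_enum.
Qed.

Lemma l2norm0 m : l2norm (0 : 'cV[R]_m) = 0.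
Proof. by rewrite -(scale0r 0) l2normZ normr0 mul0r. Qed.

Lemma l2norm_gt0 m (u : 'cV[R]_m) : u != 0 -> 0 < l2norm u.
Proof.
move=> u0; rewrite lt0r l2norm_ge0 andbT.
by apply: contra_neq u0 => /l2norm0_eq0.
Qed.

Lemma l2norm_normalized m (u : 'cV[R]_m) : u != 0 ->
  l2norm ((l2norm u)^-1 *: u) = 1.
Proof.
move=> u0; rewrite l2normZ ger0_norm ?invr_ge0 ?l2norm_ge0// mulVf//.
by apply: contra_neq u0 => /l2norm0_eq0.
Qed.

(** The difference of the two sides is [|u - 2 v|^2]. This weak triangle inequality suffices to
    compare a unit vector with its grid point. *)
Lemma sqr_l2norm_leB m (u v : 'cV[R]_m) :
  l2norm u ^+ 2 <= 2 * l2norm v ^+ 2 + 2 * l2norm (u - v) ^+ 2.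
Proof.
rewrite !sqr_l2norm !mulr_sumr -big_split/=; apply: ler_sum => i _.
rewrite !mxE -subr_ge0.
rewrite (_ : _ - _ = (u i 0 - 2 * v i 0) ^+ 2); first exact: sqr_ge0.
by ring.
Qed.

Lemma sparseZ m q c (u : 'cV[R]_m) : sparse q u -> sparse q (c *: u).
Proof.
apply: leq_trans; apply: subset_leq_card; apply/fintype.subsetP => i.
by rewrite !inE mxE; apply: contra_neq => ->; rewrite mulr0.
Qed.

(** The adjoint of [embed] with respect to [dotv]. *)
Definition restrict p (J : {set 'I_p}) (x : 'cV[R]_p) : 'cV[R]_#|J| :=
  \col_k x (enum_val k) 0.

Lemma embed_enum_val p (J : {set 'I_p}) (b : 'cV[R]_#|J|) k :
  embed b (enum_val k) 0 = b k 0.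
Proof.
rewrite mxE (eq_bigl (xpred1 k)) ?big_pred1_eq// => l.
by rewrite (inj_eq enum_val_inj).
Qed.

Lemma embed_notin p (J : {set 'I_p}) (b : 'cV[R]_#|J|) j :
  j \notin J -> embed b j 0 = 0.
Proof.
move=> jJ; rewrite mxE big_pred0// => k; apply: contraNF jJ => /eqP <-.
exact: enum_valP.
Qed.

(** Common source of [dotv_embed] and [l2norm_embed]: the terms outside [J] vanish since
    [f j 0 = 0]. *)
Lemma big_embed p (J : {set 'I_p}) (b : 'cV[R]_#|J|) (f : 'I_p -> R -> R) :
  (forall j, f j 0 = 0) ->
  \sum_j f j (embed b j 0) = \sum_k f (enum_val k) (b k 0).
Proof.
move=> f0; rewrite (bigID (mem J))/= [X in _ + X]big1 ?addr0; last first.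
  by move=> j jJ; rewrite embed_notin.
rewrite big_enum_val/=.
by apply: eq_bigr => k _; rewrite embed_enum_val.
Qed.

Lemma dotv_embed p (J : {set 'I_p}) (x : 'cV[R]_p) (b : 'cV[R]_#|J|) :
  dotv x (embed b) = dotv (restrict J x) b.
Proof.
rewrite !dotvE (@big_embed p J b (fun j t => x j 0 * t)).
  by apply: eq_bigr => k _; rewrite mxE.
by move=> j; rewrite mulr0.
Qed.

Lemma l2norm_embed p (J : {set 'I_p}) (b : 'cV[R]_#|J|) :
  l2norm (embed b) = l2norm b.
Proof.
congr Num.sqrt; rewrite (@big_embed p J b (fun _ t => t ^+ 2))// => j.
by rewrite expr0n.
Qed.

Lemma sparse_embed p q (J : {set 'I_p}) (b : 'cV[R]_#|J|) :
  (#|J| <= q)%N -> sparse q (embed b).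
Proof.
apply: leq_trans; apply: subset_leq_card; apply/fintype.subsetP => j.
by rewrite inE; apply: contraR => jJ; rewrite embed_notin.
Qed.

(** Testing the bilinear bound at [v = A u] gives [|A u|^2 <= K |A u| |u|], and [|A u|] cancels
    unless it is zero. *)
Lemma spectral_norm_le m (A : 'M[R]_m) K : 0 <= K ->
  (forall u v, dotv v (A *m u) <= K * l2norm v * l2norm u) ->
  spectral_norm A <= K.
Proof.
move=> K0 h; apply: ge_sup.
  by exists (l2norm (A *m 0)), 0 => //=; rewrite l2norm0.
move=> _ [u /= u1 <-].
have [->|Au] := eqVneq (l2norm (A *m u)) 0; first by [].
have Au0 : 0 < l2norm (A *m u) by rewrite lt0r Au l2norm_ge0.
have := h u (A *m u); rewrite -l2norm_dotv expr2 mulrAC ler_pM2r//.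
by move/le_trans; apply; rewrite ler_piMr.
Qed.

End euclidean.

(** * Bilinear form of the Hessian and its bounds *)

Section hessian.
Context {R : realType}.
Local Notation b2 := ((@logistic_cumulant R)^`(2)%classic).

Lemma neg_hessian_subE n p (X : 'I_n -> 'cV[R]_p) (J : {set 'I_p}) b :
  neg_hessian_sub X b = \sum_(i < n) b2 (dotv (X i) (embed b)) *:
    (restrict J (X i) *m (restrict J (X i))^T).
Proof.
apply/matrixP => k l; rewrite !mxE !summxE; apply: eq_bigr => i _.
rewrite [LHS]mxE [RHS]mxE; congr (_ * _); rewrite !mxE.
by rewrite !big_ord1 !mxE.
Qed.

(** All three Hessian bounds are read off this weighted sum of products of linear forms. *)
Lemma dotv_hessian n p (X : 'I_n -> 'cV[R]_p) (J : {set 'I_p}) b u v :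
  dotv v (neg_hessian_sub X b *m u) = \sum_(i < n)
    b2 (dotv (X i) (embed (J := J) b)) *
    (dotv (X i) (embed v) * dotv (X i) (embed u)).
Proof.
rewrite neg_hessian_subE mulmx_suml /dotv mulmx_sumr summxE.
apply: eq_bigr => i _; rewrite -scalemxAl -scalemxAr mxE; congr (_ * _).
set x := restrict J (X i).
have -> : v^T *m (x *m x^T *m u) = (v^T *m x) *m (x^T *m u) by rewrite !mulmxA.
rewrite [LHS]mxE big_ord1; congr (_ * _).
  by rewrite -[LHS]/(dotv _ _) -[RHS]/(dotv _ _) dotv_embed dotvC.
by rewrite -[LHS]/(dotv _ _) -[RHS]/(dotv _ _) dotv_embed.
Qed.

Lemma trmx_hessian n p (X : 'I_n -> 'cV[R]_p) (J : {set 'I_p}) b :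
  (neg_hessian_sub X b)^T = neg_hessian_sub (J := J) X b.
Proof.
rewrite neg_hessian_subE linear_sum; apply: eq_bigr => i _.
by rewrite linearZ/= trmx_mul trmxK.
Qed.

(** [a^3 + b^3 + c^3 - 3 a b c] is [(a + b + c) / 2] times the sum of the squared differences. *)
Lemma amgm3 (a b c : R) : 0 <= a -> 0 <= b -> 0 <= c ->
  a * b * c <= (a ^+ 3 + b ^+ 3 + c ^+ 3) / 3.
Proof.
move=> a0 b0 c0; rewrite -subr_ge0.
rewrite (_ : _ - _ = (a + b + c) *
  ((a - b) ^+ 2 + (b - c) ^+ 2 + (c - a) ^+ 2) / 6); last by field.
by rewrite divr_ge0// mulr_ge0 ?addr_ge0 ?sqr_ge0.
Qed.

(** A substitute for Hoelder's inequality: AM-GM applies directly to unit vectors, and homogeneity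
    gives the rest. Zero vectors, which cannot be normalised, make both sides vanish. *)
Lemma trilinear_le n p q (X : 'I_n -> 'cV[R]_p) M :
  (forall u, sparse q u ->
    \sum_(i < n) `|dotv (X i) u| ^+ 3 <= M * l2norm u ^+ 3) ->
  forall u v w, sparse q u -> sparse q v -> sparse q w ->
    \sum_(i < n) `|dotv (X i) u| * `|dotv (X i) v| * `|dotv (X i) w| <=
      M * (l2norm u * l2norm v * l2norm w).
Proof.
move=> hM.
have unit u v w : sparse q u -> sparse q v -> sparse q w ->
    l2norm u = 1 -> l2norm v = 1 -> l2norm w = 1 ->
    \sum_(i < n) `|dotv (X i) u| * `|dotv (X i) v| * `|dotv (X i) w| <= M.
  move=> su sv sw u1 v1 w1.
  have := hM u su; have := hM v sv; have := hM w sw.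
  rewrite u1 v1 w1 expr1n mulr1 => hw hv hu.
  apply: (@le_trans _ _ (\sum_(i < n) (`|dotv (X i) u| ^+ 3 +
      `|dotv (X i) v| ^+ 3 + `|dotv (X i) w| ^+ 3) / 3)).
    by apply: ler_sum => i _; exact: amgm3.
  by rewrite -mulr_suml !big_split/=; lra.
move=> u v w su sv sw.
have [->|u0] := eqVneq u 0.
  rewrite l2norm0 !mul0r mulr0 big1// => i _.
  by rewrite dotvr0 normr0 !mul0r.
have [->|v0] := eqVneq v 0.
  rewrite l2norm0 !(mul0r, mulr0) big1// => i _.
  by rewrite dotvr0 normr0 !(mul0r, mulr0).
have [->|w0] := eqVneq w 0.
  rewrite l2norm0 !(mul0r, mulr0) big1// => i _.
  by rewrite dotvr0 normr0 !(mul0r, mulr0).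
have := unit _ _ _ (sparseZ (l2norm u)^-1 su)
  (sparseZ (l2norm v)^-1 sv) (sparseZ (l2norm w)^-1 sw)
  (l2norm_normalized u0) (l2norm_normalized v0)
  (l2norm_normalized w0).
have nu := l2norm_gt0 u0; have nv := l2norm_gt0 v0; have nw := l2norm_gt0 w0.
under eq_bigr => i _.
  rewrite !dotvZr !normrM !normfV !(gtr0_norm nu, gtr0_norm nv, gtr0_norm nw).
  rewrite (_ : _ * _ * _ = (`|dotv (X i) u| * `|dotv (X i) v| * `|dotv (X i) w|)
     / (l2norm u * l2norm v * l2norm w)); last by field; rewrite !gt_eqF.
  over.
by rewrite -mulr_suml ler_pdivrMr// !mulr_gt0.
Qed.

(* The lower bound integrates e^-s >= e^(-K t) (1 + K t - s) at
   s = |X_i . b|, t = |b|: with K = M / kappa the cubic moment is absorbed. *)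
Lemma hessian_bounds n p q (X : 'I_n -> 'cV[R]_p) (kappa M : R) :
  (0 < n)%N -> 0 < kappa -> 0 < M ->
  (forall u, sparse q u ->
    kappa * n%:R * l2norm u ^+ 2 <= \sum_(i < n) dotv (X i) u ^+ 2) ->
  (forall u, sparse q u ->
    \sum_(i < n) `|dotv (X i) u| ^+ 3 <= M * n%:R * l2norm u ^+ 3) ->
  forall J : {set 'I_p}, (#|J| <= q)%N -> forall b b' : 'cV[R]_#|J|,
  [/\ loewner_le (kappa / 4 * expR (- (M / kappa * l2norm b)))%:M
        (n%:R^-1 *: neg_hessian_sub X b),
      loewner_le (n%:R^-1 *: neg_hessian_sub X b) (1 + M + l2norm b)%:M &
      n%:R^-1 * spectral_norm (neg_hessian_sub X b - neg_hessian_sub X b') <=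
        M * l2norm (b - b')].
Proof.
move=> n0 k0 M0 hk hM J Jq b b'.
have nR : 0 < n%:R :> R by rewrite ltr0n.
have tri := trilinear_le hM.
have semb (u : 'cV[R]_#|J|) := sparse_embed u Jq.
split.
- split; first by rewrite linearB/= linearZ/= trmx_hessian tr_scalar_mx.
  move=> u; rewrite mulmxBl mul_scalar_mx -scalemxAl dotvBr !dotvZr subr_ge0.
  rewrite ler_pdivlMl// dotv_hessian.
  set K := M / kappa; set t := l2norm b.
  apply: (@le_trans _ _ (\sum_(i < n) expR (- (K * t)) / 4 *
    ((1 + K * t) * dotv (X i) (embed u) ^+ 2 -
     `|dotv (X i) (embed u)| * `|dotv (X i) (embed u)| *
     `|dotv (X i) (embed b)|))); last first.
    apply: ler_sum => i _; rewrite -expr2.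
    rewrite -!expr2 -normrX ger0_norm ?sqr_ge0//.
    set s := `|dotv (X i) (embed b)|; set y := _ ^+ 2.
    have y0 : 0 <= y by exact: sqr_ge0.
    apply: (@le_trans _ _ (expR (- s) / 4 * y)); last first.
      by rewrite ler_wpM2r// logistic_weight_ge.
    have -> : - s = - (K * t) + (K * t - s) by ring.
    have e0 := expR_gt0 (- (K * t)).
    rewrite expRD.
    have -> : expR (- (K * t)) / 4 * ((1 + K * t) * y - y * s) =
       expR (- (K * t)) * (1 + (K * t - s)) / 4 * y by ring.
    rewrite ler_wpM2r// ler_wpM2r// ler_wpM2l ?(ltW e0)//.
    exact: expR_ge1Dx.
  rewrite -mulr_sumr sumrB -mulr_sumr.
  have h1 := hk _ (semb u); have h2 := tri _ _ _ (semb u) (semb u) (semb b).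
  rewrite !l2norm_embed in h1 h2.
  rewrite -l2norm_dotv.
  have e0 := expR_gt0 (- (K * t)).
  rewrite (_ : n%:R * _ = expR (- (K * t)) / 4 *
     (n%:R * kappa * l2norm u ^+ 2)); last by ring.
  rewrite ler_wpM2l ?divr_ge0 ?(ltW e0)//.
  have Kt : 0 <= 1 + K * t.
    by rewrite addr_ge0// mulr_ge0 ?l2norm_ge0// divr_ge0// ltW.
  have := ler_wpM2l Kt h1.
  have -> : (1 + K * t) * (kappa * n%:R * l2norm u ^+ 2) =
    n%:R * kappa * l2norm u ^+ 2 + M * n%:R * (l2norm u * l2norm u * t).
    by rewrite /K; field; rewrite gt_eqF.
  by move: h2; rewrite -/t; lra.
- split; first by rewrite linearB/= linearZ/= trmx_hessian tr_scalar_mx.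
  move=> u; rewrite mulmxBl mul_scalar_mx -scalemxAl dotvBr !dotvZr subr_ge0.
  rewrite ler_pdivrMl// dotv_hessian -l2norm_dotv.
  have b0 := l2norm_ge0 b.
  (* The estimate is proved for [1 + M]; the summand [l2norm b] makes the bound strictly increasing
     in the norm, as [c_upper] must be. *)
  apply: (@le_trans _ _ (n%:R * ((1 + M) * l2norm u ^+ 2))); last first.
    rewrite ler_wpM2l ?(ltW nR)// ler_wpM2r ?sqr_ge0//; lra.
  have [->|u0] := eqVneq u 0.
    rewrite l2norm0 expr0n/= !mulr0 big1// => i _.
    by rewrite !dotv_embed dotvr0 !mulr0.
  have nu := l2norm_gt0 u0.
  set N := l2norm u in nu *.
  (* [y^2] is at most [N^2] if [|y| <= N] and at most [|y|^3 / N] otherwise, so the cubic moment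
     controls the quadratic one as well. *)
  apply: (@le_trans _ _ (\sum_(i < n)
      (N ^+ 2 + `|dotv (X i) (embed u)| ^+ 3 / N))).
    apply: ler_sum => i _; rewrite -expr2.
    set y := dotv _ (embed u).
    have w1 := logistic_weight_le (dotv (X i) (embed b)).
    apply: (@le_trans _ _ (y ^+ 2)).
      rewrite ler_piMl ?sqr_ge0//.
      by apply: (le_trans w1); lra.
    rewrite -normrX -[_ ^+ 2]ger0_norm ?sqr_ge0// normrX normrX.
    move: `|y| (normr_ge0 y) => {w1}z z0.
    have [zN|/ltW zN] := leP z N.
      apply: (@le_trans _ _ (N ^+ 2)).
        by rewrite lerXn2r// nnegrE ltW.
      by rewrite lerDl divr_ge0 ?exprn_ge0// ltW.
    apply: (@le_trans _ _ (z ^+ 3 / N)); last by rewrite lerDr sqr_ge0.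
    by rewrite ler_pdivlMr// [leRHS]exprSr ler_wpM2l ?sqr_ge0.
  rewrite big_split/= sumr_const card_ord -mulr_suml -[N ^+ 2 *+ n]mulr_natl.
  have h := hM _ (semb u); rewrite l2norm_embed -/N in h.
  rewrite (mulrDl 1) mul1r mulrDr lerD2l ler_pdivrMr//.
  by apply: (le_trans h); rewrite le_eqVlt; apply/orP; left; apply/eqP; ring.
- move: (dotv_hessian X b) (dotv_hessian X b').
  move: (neg_hessian_sub X b) (neg_hessian_sub X b') => H H' HE HE'.
  rewrite ler_pdivrMl//; apply: spectral_norm_le.
    by rewrite !mulr_ge0// ?l2norm_ge0// ltW.
  move=> u v; rewrite mulmxBl dotvBr HE HE' -sumrB.
  have := tri _ _ _ (semb v) (semb u) (semb (b - b')).
  rewrite !l2norm_embed => h.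
  rewrite (_ : n%:R * _ * _ * _ =
    M * n%:R * (l2norm v * l2norm u * l2norm (b - b'))); last by ring.
  apply: le_trans h; apply: ler_sum => i _.
  (* The two weights differ by at most [|X_i . (b - b')|], which supplies the third factor of the
     trilinear form. *)
  rewrite -mulrBl; apply: le_trans (ler_norm _) _.
  rewrite !normrM mulrC ler_wpM2l ?mulr_ge0//.
  apply: le_trans (logistic_weight_lip _ _) _.
  by rewrite !dotv_embed dotvBr.
Qed.

End hessian.

(** * A grid of sparse vectors *)

Section grid.
Context {R : realType} (p q m : nat).
Hypotheses (p0 : (0 < p)%N) (q0 : (0 < q)%N) (m0 : (0 < m)%N).

(* A q-sparse point with coordinates in {-1, ..., 1} / (m q) is encoded by q
   positions and q values, so that these points number at most
   (p (2 m q + 1))^q without any count over supports. *)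
Definition grid_index : finType :=
  ({ffun 'I_q -> 'I_p} * {ffun 'I_q -> 'I_(2 * (m * q)).+1})%type.

(** A value index [l], from 0 to [2 m q], stands for the coordinate [l / (m q) - 1]. If a position
    is repeated, [pick] selects one of its values. *)
Definition grid_point (z : grid_index) : 'cV[R]_p := \col_j
  if [pick k | z.1 k == j] is Some k then (z.2 k)%:R / (m * q)%:R - 1 else 0.

Lemma card_grid_index : #|grid_index| = (p ^ q * (2 * (m * q)).+1 ^ q)%N.
Proof. by rewrite card_prod !card_ffun !card_ord. Qed.

(** The support lies in the image of [z.1], which has at most [q] elements. The rounding error in
    [grid_approx] is of this kind too, so it is [q]-sparse and not merely [2 q]-sparse. *)
Lemma sparse_grid_pos (z : grid_index) (u : 'cV[R]_p) :
  (forall j, (forall k, z.1 k != j) -> u j 0 = 0) -> sparse q u.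
Proof.
move=> h; apply: (@leq_trans #|[set z.1 k | k in 'I_q]%SET|); last first.
  by rewrite (leq_trans (leq_imset_card _ _))// card_ord.
apply: subset_leq_card; apply/fintype.subsetP => j; rewrite inE.
apply: contraR => jz; apply/eqP/h => k; apply: contraNneq jz => <-.
exact: imset_f.
Qed.

Lemma sparse_grid_point z : sparse q (grid_point z).
Proof.
apply: (@sparse_grid_pos z) => j jz; rewrite mxE; case: pickP => //= k.
by rewrite (negbTE (jz k)).
Qed.

(* Rounds t in [-1, 1] to the grid of mesh 1 / (m q). *)
Definition grid_round (t : R) : 'I_(2 * (m * q)).+1 :=
  inord (Num.truncn ((t + 1) * (m * q)%:R)).

Lemma grid_roundP t : -1 <= t <= 1 ->
  `|t - ((grid_round t)%:R / (m * q)%:R - 1)| <= (m * q)%:R^-1.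
Proof.
move=> /andP[t1 t2].
have N0 : 0 < (m * q)%:R :> R by rewrite ltr0n muln_gt0 m0.
have t10 : 0 <= t + 1 by lra.
have t12 : t + 1 <= 2 by lra.
have s0 : 0 <= (t + 1) * (m * q)%:R by rewrite mulr_ge0// ltW.
have /andP[h1 h2] := truncn_itv s0.
(* At [t = 1] the truncation reaches [2 m q], the last index of the ordinal type, so [inord] never
   falls back on its default. *)
rewrite /grid_round inordK; last first.
  rewrite ltnS -(ler_nat R) (le_trans h1)// [leRHS]natrM ler_wpM2r// ltW.
move: (Num.truncn _) h1 h2 => k; move: (m * q)%:R N0 {s0} => N N0 h1 h2.
have -> : t - (k%:R / N - 1) = ((t + 1) * N - k%:R) / N.
  by field; rewrite gt_eqF.
rewrite normrM [`|_^-1|]gtr0_norm ?invr_gt0// ler_piMl ?invr_ge0 ?(ltW N0)//.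
rewrite ger0_norm ?subr_ge0// lerBlDl.
by rewrite -natr1 in h2; exact: ltW.
Qed.

(** At most [q] coordinates of the error are nonzero and each is at most [1 / (m q)] in modulus, so
    its squared norm is at most [1 / (m^2 q)]. *)
Lemma grid_approx (u : 'cV[R]_p) : sparse q u -> l2norm u = 1 ->
  exists z, sparse q (u - grid_point z) /\
    l2norm (u - grid_point z) ^+ 2 <= m%:R ^- 2.
Proof.
move=> su u1.
pose J := [set j | u j 0 != 0]%SET; pose j0 := Ordinal p0.
have Jq : (#|J| <= q)%N by rewrite cardsE.
(* Positions beyond [#|J|] default to [j0]. They store the rounding of [u] at [j0], so repeated
   positions always agree. *)
pose pos : {ffun 'I_q -> 'I_p} := [ffun k : 'I_q => nth j0 (enum J) k].
pose z : grid_index := (pos, [ffun k => grid_round (u (pos k) 0)]).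
have posJ j : u j 0 != 0 -> exists k, pos k = j.
  move=> uj; have jJ : j \in enum J by rewrite mem_enum inE.
  have jq : (index j (enum J) < q)%N.
    by apply: (leq_trans _ Jq); rewrite cardE index_mem.
  by exists (Ordinal jq); rewrite ffunE/= nth_index.
have zE j : (grid_point z j 0 = 0 /\ u j 0 = 0 /\ forall k, pos k != j) \/
   grid_point z j 0 = (grid_round (u j 0))%:R / (m * q)%:R - 1 /\
   exists k, pos k = j.
  rewrite mxE; case: pickP => /= [k /eqP kj|h]; [right|left].
    by rewrite ffunE kj; split=> //; exists k.
  have hk k : pos k != j by rewrite h.
  split=> //; split=> //; apply/eqP; apply: contraT => /posJ[k kj].
  by move: (hk k); rewrite kj eqxx.
have subE j : (u - grid_point z) j 0 = u j 0 - grid_point z j 0.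
  by rewrite [LHS]mxE; congr (_ + _); rewrite [LHS]mxE.
have su' : sparse q (u - grid_point z).
  apply: (@sparse_grid_pos z) => j jz; rewrite !mxE.
  have [[]|] := zE j; last by move=> [_ [k kj]]; move: (jz k); rewrite kj eqxx.
  by rewrite mxE => -> [-> _]; rewrite subr0.
exists z; split=> //; rewrite sqr_l2norm.
have uitv j : -1 <= u j 0 <= 1.
  rewrite -ler_norml -(@ler_pXn2r _ 2) ?nnegrE// expr1n real_normK ?num_real//.
  rewrite -[leRHS](expr1n _ 2) -u1 sqr_l2norm (bigD1 j)//= lerDl sumr_ge0//.
  by move=> i _; exact: sqr_ge0.
rewrite (bigID [pred j | (u - grid_point z) j 0 != 0])/=.
rewrite [X in _ + X]big1 ?addr0.
  apply: (@le_trans _ _ (\sum_(j | (u - grid_point z) j 0 != 0)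
      (m * q)%:R ^- 2 : R)).
    apply: ler_sum => j uj.
    rewrite -[leLHS]real_normK ?num_real// -exprVn lerXn2r ?nnegrE ?invr_ge0//.
    have [[g0 [u0 _]]|[g _]] := zE j.
      by move: uj; rewrite subE u0 g0 subr0 eqxx.
    by rewrite subE g; exact: grid_roundP.
  rewrite sumr_const -[leLHS]mulr_natl.
  apply: (@le_trans _ _ (q%:R * (m * q)%:R ^- 2)).
    by rewrite ler_wpM2r ?invr_ge0 ?exprn_ge0// ler_nat.
  have qR : 0 < q%:R :> R by rewrite ltr0n.
  have mR : 0 < m%:R :> R by rewrite ltr0n.
  rewrite natrM.
  have -> : q%:R * (m%:R * q%:R) ^- 2 = m%:R ^- 2 / q%:R :> R.
    by field; rewrite !gt_eqF.
  by rewrite ler_piMr ?invr_ge0 ?exprn_ge0// invf_le1// ler1n.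
by move=> j; rewrite negbK => /eqP ->; rewrite expr0n.
Qed.

End grid.

(** * Chernoff bounds for i.i.d. bounded variables *)

Section chernoff.
Context d (T : measurableType d) (R : realType) (P : probability T R).

Lemma measure_bigsetU_le (I : Type) (s : seq I) (B : pred I) (A : I -> set T) :
  (forall i, measurable (A i)) ->
  (P (\big[setU/set0]_(i <- s | B i) A i) <= \sum_(i <- s | B i) P (A i))%E.
Proof.
move=> mA; elim: s => [|i s ih]; first by rewrite !big_nil measure0.
rewrite !big_cons; case: ifP => // _.
apply: (le_trans (measureU2 _ _ _)) => //; last by rewrite leeD2l.
exact: bigsetU_measurable.
Qed.

Lemma subset_bigsetU (I : finType) (B : pred I) (A : I -> set T) i :
  B i -> A i `<=` \big[setU/set0]_(j | B j) A j.
Proof. by move=> Bi w Aw; rewrite (bigD1 i)//=; left. Qed.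

Context d' (T' : measurableType d').

(** Independence is a statement on events, so it is used on class patterns: [A] is covered by the
    patterns in [B], and the probability of each pattern factors. *)
Lemma prob_classified_le (I : finType) (i0 : I) (X : I -> {RV P >-> T'})
    (K : nat) (h : T' -> 'I_K) (B : pred {ffun I -> 'I_K}) (A : set T) :
  iid X -> (forall k, measurable (h @^-1` [set k])) -> measurable A ->
  (forall w, A w -> B [ffun i => h (X i w)]) ->
  (P A <= (\sum_(z | B z)
     \prod_i fine (P (X i0 @^-1` (h @^-1` [set z i]))))%:E)%E.
Proof.
move=> [indep ident] mh mA AB.
have mX i k : measurable (X i @^-1` (h @^-1` [set k])).
  by rewrite -[_ @^-1` _]setTI; apply: measurable_funP.
have mC (z : {ffun I -> 'I_K}) :
    measurable (\bigcap_i (X i @^-1` (h @^-1` [set z i]))).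
  by apply: fin_bigcap_measurable => //; exact: finite_finset.
pose U := \big[setU/set0]_(z | B z)
  \bigcap_i (X i @^-1` (h @^-1` [set (z : {ffun I -> 'I_K}) i])).
apply: (@le_trans _ _ (P U)).
  apply: le_measure; rewrite ?inE//; first exact: bigsetU_measurable.
  move=> w /AB Bw; apply: (subset_bigsetU Bw) => i _ /=; by rewrite ffunE.
apply: (le_trans (measure_bigsetU_le _ _ mC)).
rewrite -sumEFin; apply: lee_sum => z _.
rewrite (indep (fun i => h @^-1` [set z i]))// -prodEFin.
rewrite le_eqVlt; apply/orP; left; apply/eqP; apply: eq_bigr => i _.
rewrite fineK; last exact: fin_num_measure.
exact: (ident i i0).
Qed.

Lemma classified_indic (K : nat) (h : T -> 'I_K) (v : 'I_K -> R) w :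
  v (h w) = \sum_k v k * \1_(h @^-1` [set k]) w.
Proof.
rewrite (bigD1 (h w))//= big1 ?addr0.
  by rewrite indicE mem_set// mulr1.
by move=> k kh; rewrite indicE memNset ?mulr0//= => /esym/eqP; exact/negP.
Qed.

Lemma measurable_classified (K : nat) (h : T -> 'I_K) (v : 'I_K -> R) :
  (forall k, measurable (h @^-1` [set k])) ->
  measurable_fun setT (fun w => v (h w)).
Proof.
move=> mh; rewrite (_ : (fun _ => _) = fun w =>
  \sum_k v k * \1_(h @^-1` [set k]) w); last first.
  by apply/funext => w; exact: classified_indic.
by apply: measurable_sum => k; exact: measurable_funM.
Qed.

Lemma integral_classified (K : nat) (h : T -> 'I_K) (v : 'I_K -> R) :
  (forall k, measurable (h @^-1` [set k])) -> (forall k, 0 <= v k) ->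
  (\int[P]_w (v (h w))%:E = (\sum_k v k * fine (P (h @^-1` [set k])))%:E)%E.
Proof.
move=> mh v0.
have m1 k : measurable_fun setT (fun w => (\1_(h @^-1` [set k]) w)%:E : \bar R).
  by apply/measurable_EFinP; exact: measurable_indic.
under eq_integral => w _ do rewrite classified_indic -sumEFin.
under eq_integral => w _ do under eq_bigr => k _ do rewrite EFinM.
rewrite ge0_integral_sum//=; last 2 first.
- by move=> k; exact: measurable_funeM.
- by move=> k w _; rewrite mule_ge0 ?lee_fin.
rewrite -sumEFin; apply: eq_bigr => k _.
rewrite ge0_integralZl//= ?lee_fin//.
by rewrite integral_indic// setIT EFinM fineK// fin_num_measure.
Qed.

(** The limit [s -> 0] in explicit form: [e^(- s a) >= 1 - s a] gives [x <= C + x s a], and [s] is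
    chosen to make the last term at most [e]. *)
Lemma le_of_expR_slack (x C a : R) : 0 <= x ->
  (forall s, 0 < s -> x <= C * expR (s * a)) -> x <= C.
Proof.
move=> x0 h; apply/ler_addgt0Pr => e e0.
pose s := e / (x * `|a| + 1).
have D0 : 0 < x * `|a| + 1 by rewrite ltr_wpDl// mulr_ge0.
have s0 : 0 < s by rewrite divr_gt0.
have h1 : x * expR (- (s * a)) <= C.
  by rewrite expRN ler_pdivrMr ?expR_gt0//; exact: h.
have h2 : x * (1 - s * a) <= x * expR (- (s * a)).
  by rewrite ler_wpM2l// expR_ge1Dx.
have h3 : x * (s * a) <= e.
  apply: (@le_trans _ _ (s * (x * `|a| + 1))); last first.
    by rewrite /s divfK// gt_eqF.
  rewrite mulrCA ler_wpM2l// ?(ltW s0)//.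
  by rewrite ler_wpDr// ler_wpM2l// ler_norm.
lra.
Qed.

(** Markov's inequality for the exponential of the sum, with the values of [f] sorted into cells of
    length [s]. The cells cost a factor [e^s] per variable, which [le_of_expR_slack] removes. *)
Lemma chernoff (I : finType) (i0 : I) (X : I -> {RV P >-> T'}) (f : T' -> R)
    (b M t : R) :
  iid X -> measurable_fun setT f -> (forall x, 0 <= f x <= b) ->
  (\int[P]_w (expR (f (X i0 w)))%:E <= M%:E)%E ->
  (P [set w | (t <= \sum_i f (X i w))%R] <= (expR (- t) * M ^+ #|I|)%:E)%E.
Proof.
move=> iidX mf fb intM; set A := [set w | _].
have mfX i : measurable_fun setT (fun w => f (X i w)).
  exact: measurableT_comp.
have mA : measurable A.
  have -> : A = (fun w => \sum_i f (X i w)) @^-1` `[t, +oo[%classic.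
    by apply/seteqP; split=> w /=; rewrite in_itv/= andbT.
  rewrite -[_ @^-1` _]setTI; apply: measurable_sum => //.
have PA : P A \is a fin_num by exact: fin_num_measure.
rewrite -(fineK PA) lee_fin.
apply: (@le_of_expR_slack _ _ #|I|%:R); first by rewrite fine_ge0.
move=> s s0; rewrite -lee_fin (fineK PA).
(* The value [b] may fall into cell [Num.truncn (b / s)], hence the successor. *)
pose K := (Num.truncn (b / s)).+1.
pose h (x : T') : 'I_K := inord (Num.truncn (f x / s)).
have fs0 x : 0 <= f x / s.
  by have /andP[f0 _] := fb x; rewrite divr_ge0// ltW.
have hE x : h x = Num.truncn (f x / s) :> nat.
  rewrite inordK// ltnS; apply: le_truncn.
  by rewrite ler_pM2r ?invr_gt0//; have /andP[] := fb x.
have hP x : s * (h x)%:R <= f x <= s * ((h x)%:R + 1).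
  have := truncn_itv (fs0 x); rewrite -hE -natr1 => /andP[h1 h2].
  by rewrite mulrC -ler_pdivlMr// h1/= mulrC -ler_pdivrMr// ltW.
have mh k : measurable (h @^-1` [set k]).
  have -> : h @^-1` [set k] = f @^-1` `[s * k%:R, s * (k%:R + 1)[%classic.
    apply/seteqP; split=> x /=.
      move=> <-; rewrite in_itv/=; have := truncn_itv (fs0 x).
      rewrite -hE -natr1 => /andP[h1 h2].
      by rewrite mulrC -ler_pdivlMr// h1/= mulrC -ltr_pdivrMr.
    rewrite in_itv/= ![s * _]mulrC -ler_pdivlMr// -ltr_pdivrMr// natr1 => h1.
    by apply/val_inj => /=; rewrite hE; apply: truncn_def.
  by rewrite -[_ @^-1` _]setTI; apply: mf.
(* Upper ends of cells, so that every outcome in [A] has its pattern in [B]. *)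
pose B (z : {ffun I -> 'I_K}) := t <= \sum_i s * ((z i)%:R + 1).
pose pi k := fine (P (X i0 @^-1` (h @^-1` [set k]))).
have pi0 k : 0 <= pi k by rewrite fine_ge0.
apply: (le_trans (@prob_classified_le I i0 X K h B A iidX mh mA _)).
  move=> w /= Aw; apply: (le_trans Aw); apply: ler_sum => i _.
  by rewrite ffunE; have /andP[] := hP (X i w).
rewrite lee_fin.
(* Lower ends of cells, so that the discrete exponential moment does not exceed the integral. *)
have int_pi : \sum_(k < K) expR (s * k%:R) * pi k <= M.
  rewrite -lee_fin; apply: le_trans intM.
  have mhX k : measurable ((h \o X i0) @^-1` [set k]).
    by rewrite comp_preimage -[_ @^-1` _]setTI; exact: measurable_funP.
  rewrite -(@integral_classified K (h \o X i0)
    (fun k : 'I_K => expR (s * k%:R)) mhX)//.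
  apply: ge0_le_integral => //=.
  - apply/measurable_EFinP.
    exact: (measurable_classified (fun k : 'I_K => expR (s * k%:R)) mhX).
  - by apply/measurable_EFinP; exact: measurableT_comp.
  - by move=> w _; rewrite lee_fin ler_expR; have /andP[] := hP (X i0 w).
(* On [B] the upper ends sum to at least [t], so the exponential factor is at least 1; the other
   patterns only add nonnegative terms. *)
apply: (@le_trans _ _ (\sum_(z : {ffun I -> 'I_K}) expR (- t) *
    \prod_i (expR s * (expR (s * (z i)%:R) * pi (z i))))).
  rewrite [leRHS](bigID B)/= ler_wpDr//.
    apply: sumr_ge0 => z _; rewrite mulr_ge0 ?expR_ge0// prodr_ge0// => i _.
    by rewrite !mulr_ge0 ?expR_ge0.
  apply: ler_sum => z Bz.
  under [in leRHS]eq_bigr => i _ do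
    rewrite mulrA -expRD -[X in X + _]mulr1 -mulrDr [1 + _]addrC.
  rewrite big_split/= -expR_sum mulrA -expRD ler_peMl//.
    by apply: prodr_ge0 => i _; exact: pi0.
  by rewrite -[leLHS]expR0 ler_expR addrC subr_ge0.
rewrite -mulr_sumr.
(* The sum over all patterns factors into one sum over cells for each variable. *)
rewrite -(bigA_distr_bigA
  (fun _ (k : 'I_K) => expR s * (expR (s * k%:R) * pi k))).
rewrite prodr_const -mulrA ler_wpM2l ?expR_ge0//.
rewrite -mulr_sumr exprMn mulrC -expRM_natr.
rewrite ler_wpM2r ?expR_ge0// lerXn2r ?nnegrE//.
  by apply: sumr_ge0 => k _; rewrite mulr_ge0 ?expR_ge0.
by apply: le_trans int_pi; apply: sumr_ge0 => k _; rewrite mulr_ge0 ?expR_ge0.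
Qed.

End chernoff.

(** * Upper and lower tails in terms of the mean *)

Section chernoff_tails.
Context d (T : measurableType d) (R : realType) (P : probability T R).
Context d' (T' : measurableType d').
Variables (I : finType) (i0 : I) (X : I -> {RV P >-> T'}) (iidX : iid X).
Variables (Y : T' -> R) (B mu : R).
Hypotheses (mY : measurable_fun setT Y) (B0 : 0 < B).
Hypothesis (YB : forall x, 0 <= Y x <= B).

Let Y0 x : 0 <= Y x. Proof. by have /andP[] := YB x. Qed.

Let mYX : measurable_fun setT (fun w => Y (X i0 w)).
Proof. exact: measurableT_comp. Qed.

(** [(1 - y) e^y <= 1 <= (1 - y) (1 + 2 y)], the second inequality because [y <= 1/2]. *)
Lemma expR_le1D2x (y : R) : 0 <= y -> y <= 2^-1 -> expR y <= 1 + 2 * y.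
Proof.
move=> y0 y1; have e := expR_ge1Dx (- y); rewrite expRN in e.
have ey := expR_gt0 y.
have h : (1 - y) * expR y <= 1 by rewrite -ler_pdivlMr// mul1r.
have y3 : 0 <= y * (1 - 2 * y) by apply: mulr_ge0; lra.
have y2 : 0 < 1 - y by lra.
rewrite -(ler_pM2l y2); apply: (le_trans h); rewrite -subr_ge0.
by rewrite (_ : _ - _ = y * (1 - 2 * y)) //; ring.
Qed.

(** [(1 - y / 2) (1 + y) = 1 + y (1 - y) / 2 >= 1], and [1 + y <= e^y]. *)
Lemma expRN_le1Bx (y : R) : 0 <= y <= 1 -> expR (- y) <= 1 - y / 2.
Proof.
move=> /andP[y0 y1]; have e := expR_ge1Dx y; have ey := expR_gt0 y.
rewrite expRN -[leLHS]mul1r ler_pdivrMr//.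
have y3 : 0 <= y * (1 - y) / 2 by rewrite divr_ge0// mulr_ge0//; lra.
apply: (@le_trans _ _ ((1 - y / 2) * (1 + y))).
  by rewrite -subr_ge0 (_ : _ - _ = y * (1 - y) / 2) //; field.
by rewrite ler_wpM2l//; lra.
Qed.

(** Chernoff for [Y / (2 B)], which lies in the range of [expR_le1D2x]: the exponential moment is at
    most [1 + mu / B <= e^(mu / B)], and the surplus 1 in the threshold leaves the rate [1 / (2 B)]
    per variable. *)
Lemma chernoff_upper : (\int[P]_w (Y (X i0 w))%:E <= mu%:E)%E ->
  (P [set w | (#|I|%:R * (2 * mu + 1) <= \sum_i Y (X i w))%R] <=
    (expR (- (#|I|%:R / (2 * B))))%:E)%E.
Proof.
move=> intY; have D0 : 0 < 2 * B by rewrite mulr_gt0.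
have mf : measurable_fun setT (fun x => Y x / (2 * B)).
  by exact: measurable_funM.
have fb x : 0 <= Y x / (2 * B) <= 2^-1.
  have /andP[h0 h1] := YB x; rewrite divr_ge0 ?(ltW D0)//=.
  by rewrite ler_pdivrMr// mulrA mulVf// mul1r.
have intf : (\int[P]_w (expR (Y (X i0 w) / (2 * B)))%:E <=
    (expR (mu / B))%:E)%E.
  apply: (@le_trans _ _ (\int[P]_w (1%:E + (B^-1)%:E * (Y (X i0 w))%:E))%E).
    apply: ge0_le_integral => //=.
    - apply/measurable_EFinP; apply: measurableT_comp => //.
      exact: (measurableT_comp mf).
    - apply/measurable_EFinP; apply: measurable_funD => //.
      exact: measurable_funM.
    - move=> w _; rewrite -EFinM -EFinD lee_fin.
      have /andP[h0 h1] := fb (X i0 w).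
      apply: le_trans (expR_le1D2x h0 h1) _.
      rewrite le_eqVlt; apply/orP; left; apply/eqP; field.
      by rewrite gt_eqF.
  rewrite ge0_integralD//=; last 2 first.
  - by move=> w _; rewrite mule_ge0 ?lee_fin// invr_ge0 ltW.
  - by apply: measurable_funeM; exact/measurable_EFinP.
  rewrite integral_cst// [X in (X + _)%E](_ : _ = 1%:E); last first.
    by rewrite mul1e; exact: probability_setT.
  have Bi : (0 <= (B^-1)%:E :> \bar R)%E by rewrite lee_fin invr_ge0 ltW.
  rewrite ge0_integralZl//; last 2 first.
  - exact/measurable_EFinP.
  - by move=> w _; rewrite lee_fin.
  apply: (@le_trans _ _ (1%:E + (B^-1)%:E * mu%:E)%E).
    by rewrite leeD2l// lee_wpmul2l.
  by rewrite -EFinM -EFinD lee_fin mulrC expR_ge1Dx.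
have := chernoff (#|I|%:R * (2 * mu + 1) / (2 * B)) iidX mf fb intf.
have -> : [set w | (#|I|%:R * (2 * mu + 1) / (2 * B) <=
    \sum_i Y (X i w) / (2 * B))%R] =
    [set w | (#|I|%:R * (2 * mu + 1) <= \sum_i Y (X i w))%R].
  apply/seteqP; split=> w /=.
    by rewrite -mulr_suml ler_pM2r ?invr_gt0.
  by rewrite -mulr_suml ler_pM2r ?invr_gt0.
move/le_trans; apply; rewrite lee_fin -expRM_natr -expRD ler_expR.
rewrite le_eqVlt; apply/orP; left; apply/eqP; field.
by rewrite gt_eqF.
Qed.

(** Chernoff for [1 - Y / B], which is nonnegative as [chernoff] requires. Its exponential moment is
    at most [e (1 - mu / (2 B))]; half of the gain [mu / (2 B)] pays for the threshold [mu / 4]. *)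
Lemma chernoff_lower : (mu%:E <= \int[P]_w (Y (X i0 w))%:E)%E ->
  (P [set w | (\sum_i Y (X i w) <= #|I|%:R * (mu / 4))%R] <=
    (expR (- (#|I|%:R * mu / (4 * B))))%:E)%E.
Proof.
move=> intY.
have mf : measurable_fun setT (fun x => 1 - Y x / B).
  by apply: measurable_funB => //; exact: measurable_funM.
have yb x : 0 <= Y x / B <= 1.
  have /andP[h0 h1] := YB x; rewrite divr_ge0 ?(ltW B0)//=.
  by rewrite ler_pdivrMr// mul1r.
have fb x : 0 <= 1 - Y x / B <= 1 by have := yb x; lra.
have intf : (\int[P]_w (expR (1 - Y (X i0 w) / B))%:E <=
    (expR (1 - mu / (2 * B)))%:E)%E.
  have mE : measurable_fun setT
      (fun w => (expR (1 - Y (X i0 w) / B))%:E : \bar R).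
    apply/measurable_EFinP; apply: measurableT_comp => //.
    exact: (measurableT_comp mf).
  pose c := expR 1 / (2 * B).
  have c0 : 0 <= c by rewrite divr_ge0 ?expR_ge0// mulr_ge0// ltW.
  (* Stated as a sum, so that only integrals of nonnegative functions are added; the subtraction
     comes once the second term is the finite [c mu]. *)
  have h : (\int[P]_w (expR (1 - Y (X i0 w) / B))%:E +
      c%:E * \int[P]_w (Y (X i0 w))%:E <= (expR 1)%:E)%E.
    rewrite -ge0_integralZl//; last 2 first.
    - exact/measurable_EFinP.
    - by move=> w _; rewrite lee_fin.
    rewrite -ge0_integralD//=; last 2 first.
    - by move=> w _; rewrite mule_ge0 ?lee_fin.
    - by apply: measurable_funeM; exact/measurable_EFinP.
    apply: (@le_trans _ _ (\int[P]_w (cst (expR 1)%:E w))%E); last first.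
      rewrite integral_cst// [X in (_ * X)%E](_ : _ = 1%:E) ?mule1//.
      exact: probability_setT.
    apply: ge0_le_integral => //=.
    - move=> w _; rewrite -EFinM -EFinD lee_fin addr_ge0 ?expR_ge0//.
      by rewrite mulr_ge0.
    - apply: emeasurable_funD => //.
      by apply: measurable_funeM; exact/measurable_EFinP.
    - move=> w _; rewrite -EFinM -EFinD lee_fin expRD.
      have := ler_wpM2l (expR_ge0 1) (expRN_le1Bx (yb (X i0 w))).
      rewrite /c => h; rewrite -lerBrDr; apply: (le_trans h).
      rewrite le_eqVlt; apply/orP; left; apply/eqP; field.
      by rewrite gt_eqF.
  have h2 : (\int[P]_w (expR (1 - Y (X i0 w) / B))%:E + (c * mu)%:E <=
      (expR 1)%:E)%E.
    by apply: le_trans h; rewrite EFinM leeD2l// lee_wpmul2l// lee_fin.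
  rewrite -leeBrDr// in h2; apply: (le_trans h2).
  rewrite -EFinB lee_fin expRD.
  have := ler_wpM2l (expR_ge0 1) (expR_ge1Dx (- (mu / (2 * B)))).
  apply: le_trans.
  rewrite /c le_eqVlt; apply/orP; left; apply/eqP; field.
  by rewrite gt_eqF.
have := chernoff (#|I|%:R - #|I|%:R * (mu / 4) / B) iidX mf fb intf.
have -> : [set w | (#|I|%:R - #|I|%:R * (mu / 4) / B <=
    \sum_i (1 - Y (X i w) / B))%R] =
    [set w | (\sum_i Y (X i w) <= #|I|%:R * (mu / 4))%R].
  apply/seteqP; split=> w /=; rewrite sumrB sumr_const -mulr_suml;
    by rewrite lerD2l lerN2 ler_pM2r ?invr_gt0.
move/le_trans; apply; rewrite lee_fin -expRM_natr -expRD ler_expR.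
rewrite le_eqVlt; apply/orP; left; apply/eqP; field.
by rewrite gt_eqF.
Qed.

End chernoff_tails.

(** * Uniform moment bounds *)

Section grid_to_sphere.
Context {R : realType} (n p q m : nat) (X : 'I_n -> 'cV[R]_p) (a M : R).
Hypotheses (p0 : (0 < p)%N) (q0 : (0 < q)%N) (m1 : (1 < m)%N).
Hypotheses (a0 : 0 < a) (M0 : 0 <= M).

Let F (u : 'cV[R]_p) := \sum_i `|dotv (X i) u| ^+ 3.
Let G (u : 'cV[R]_p) := \sum_i dotv (X i) u ^+ 2.

Let F_ge0 u : 0 <= F u.
Proof. by apply: sumr_ge0 => i _; rewrite exprn_ge0. Qed.

Let FZ c u : F (c *: u) = `|c| ^+ 3 * F u.
Proof.
rewrite /F mulr_sumr; apply: eq_bigr => i _.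
by rewrite dotvZr normrM exprMn.
Qed.

Let GZ c u : G (c *: u) = c ^+ 2 * G u.
Proof.
by rewrite /G mulr_sumr; apply: eq_bigr => i _; rewrite dotvZr exprMn.
Qed.

(** [4 s^3 + 4 t^3 - (s + t)^3 = 3 (s + t) (s - t)^2], applied after the triangle inequality. *)
Let FB u v : F u <= 4 * F v + 4 * F (u - v).
Proof.
rewrite /F !mulr_sumr -big_split/=; apply: ler_sum => i _.
rewrite dotvBr; set x := dotv (X i) u; set y := dotv (X i) v.
have hx : `|x| <= `|y| + `|x - y|.
  by rewrite -{1}(subrK y x) addrC; exact: ler_normD.
apply: (@le_trans _ _ ((`|y| + `|x - y|) ^+ 3)).
  by rewrite lerXn2r ?nnegrE ?addr_ge0.
have := normr_ge0 y; have := normr_ge0 (x - y).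
move: `|y| `|x - y| => s t t0 s0; rewrite -subr_ge0.
rewrite (_ : _ - _ = 3 * ((s + t) * (s - t) ^+ 2)); last by ring.
by rewrite mulr_ge0// mulr_ge0 ?sqr_ge0 ?addr_ge0.
Qed.

Let GB u v : G v <= 2 * G u + 2 * G (u - v).
Proof.
rewrite /G !mulr_sumr -big_split/=; apply: ler_sum => i _.
rewrite dotvBr; set x := dotv (X i) u; set y := dotv (X i) v.
rewrite -subr_ge0 (_ : _ - _ = (2 * x - y) ^+ 2) ?sqr_ge0//; by ring.
Qed.

(** Since [x^2 <= 1 + x^3] for [x >= 0], the cubic bound also limits the quadratic form of a
    rounding error. *)
Let GF u : G u <= n%:R + F u.
Proof.
rewrite (_ : n%:R = \sum_(i < n) 1); last by rewrite sumr_const card_ord.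
rewrite -big_split/=; apply: ler_sum => i _.
rewrite -[leLHS]ger0_norm ?sqr_ge0// normrX.
move: `|_| (normr_ge0 (dotv (X i) u)) => x x0.
have [x1|/ltW x1] := leP x 1.
  by apply: ler_wpDr; rewrite ?exprn_ge0// exprn_ile1.
by apply: ler_wpDl => //; rewrite [leRHS]exprSr ler_peMr// sqr_ge0.
Qed.

(** A crude bound depending on the realisation; it serves to make the supremum in
    [cubic_moment_unit] finite. *)
Let F_bounded : exists b, forall u, l2norm u = 1 -> F u <= b.
Proof.
exists (\sum_i (\sum_j `|X i j 0|) ^+ 3) => u u1.
apply: ler_sum => i _; rewrite lerXn2r ?nnegrE ?sumr_ge0//.
rewrite dotvE; apply: le_trans (ler_norm_sum _ _ _) _; apply: ler_sum => j _.
rewrite normrM ler_piMr//.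
rewrite -(@ler_pXn2r _ 2) ?nnegrE// expr1n real_normK ?num_real//.
rewrite -[leRHS](expr1n _ 2) -u1 sqr_l2norm (bigD1 j)//= lerDl sumr_ge0//.
by move=> k _; exact: sqr_ge0.
Qed.

Let unit_scale (u : 'cV[R]_p) : u != 0 -> u = l2norm u *: ((l2norm u)^-1 *: u).
Proof. by move=> u0; rewrite scalerA divff ?scale1r// gt_eqF// l2norm_gt0. Qed.

Hypothesis gridF : forall z : grid_index p q m, grid_point z != 0 :> 'cV[R]_p ->
  F ((l2norm (grid_point z))^-1 *: grid_point z) <= M * n%:R.
Hypothesis gridG : forall z : grid_index p q m, grid_point z != 0 :> 'cV[R]_p ->
  a / 4 * n%:R <= G ((l2norm (grid_point z))^-1 *: grid_point z).

(** Since [m >= 2] the error has norm at most 1/2, and [sqr_l2norm_leB] in both directions confines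
    the norm of the grid point to [1/2, 2]. *)
Let approx (u : 'cV[R]_p) : sparse q u -> l2norm u = 1 ->
  exists z : grid_index p q m,
  [/\ sparse q (u - grid_point z),
    l2norm (u - grid_point z) ^+ 2 <= m%:R ^- 2,
    2^-1 <= l2norm (grid_point z : 'cV[R]_p) <= 2 &
    l2norm (u - grid_point z) <= 2^-1].
Proof.
move=> su u1; have m0 : (0 < m)%N by exact: ltnW.
have [z [sz hz]] := grid_approx p0 q0 m0 su u1.
exists z; set v : 'cV[R]_p := grid_point z in sz hz *.
have m4 : (m%:R ^- 2 : R) <= 4^-1.
  have m2 : (2 <= m%:R :> R) by rewrite ler_nat.
  rewrite lef_pV2 ?posrE ?exprn_gt0 ?ltr0n//.
  have := @lerXn2r R 2 2 m%:R; rewrite !nnegrE => /(_ _ _ m2); lra.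
have w4 : l2norm (u - v) ^+ 2 <= 4^-1 by exact: le_trans m4.
have wC : l2norm (v - u) = l2norm (u - v).
  by rewrite -opprB -scaleN1r l2normZ normrN1 mul1r.
have := sqr_l2norm_leB u v; have := sqr_l2norm_leB v u.
rewrite wC u1 => h1 h2.
split=> //.
  by apply/andP; split; rewrite -(@ler_pXn2r _ 2) ?nnegrE ?l2norm_ge0//; lra.
by rewrite -(@ler_pXn2r _ 2) ?nnegrE ?l2norm_ge0//; lra.
Qed.

Let v_neq0 (v : 'cV[R]_p) : 2^-1 <= l2norm v -> v != 0.
Proof. by apply: contraTneq => ->; rewrite l2norm0 -ltNge. Qed.

(* With S the supremum of F over sparse unit vectors, the rounding error u - v
   is again sparse, whence F u <= 4 F v + 4 F (u - v) <= 32 M n + S / 2. *)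
Lemma cubic_moment_unit (u : 'cV[R]_p) : sparse q u -> l2norm u = 1 ->
  F u <= 64 * M * n%:R.
Proof.
move=> su u1; have [b hb] := F_bounded.
pose E := [set F v | v in [set v | sparse q v /\ l2norm v = 1]].
have Esup : has_sup E.
  split; first by exists (F u), u.
  by exists b => _ [v [_ v1] <-]; exact: hb.
have ES v : sparse q v -> l2norm v = 1 -> F v <= sup E.
  by move=> sv v1; apply: ub_le_sup; [exact: Esup.2|exists v].
have S0 : 0 <= sup E by apply: le_trans (ES u su u1).
have n0 : (0 : R) <= n%:R by [].
(* As the supremum is finite, its half can be moved to the left. *)
suff h : sup E <= 32 * M * n%:R + sup E / 2.
  by apply: (le_trans (ES u su u1)); lra.
apply: ge_sup; first exact: Esup.1.
move=> _ [v [sv v1] <-].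
have [z [sz _ /andP[z1 z2] hz]] := approx sv v1.
set w := grid_point z in sz z1 z2 hz.
have w0 := v_neq0 z1.
have Fw : F w <= 8 * (M * n%:R).
  rewrite (unit_scale w0) FZ ger0_norm ?l2norm_ge0//.
  apply: ler_pM; rewrite ?exprn_ge0 ?l2norm_ge0 ?gridF//.
  have -> : 8 = 2 ^+ 3 :> R by ring.
  by rewrite lerXn2r // ?nnegrE ?l2norm_ge0.
have Fvw : F (v - w) <= 8^-1 * sup E.
  have [->|vw0] := eqVneq (v - w) 0.
    by rewrite -(scale0r 0) FZ normr0 expr0n mul0r mulr_ge0.
  rewrite (unit_scale vw0) FZ ger0_norm ?l2norm_ge0//.
  apply: ler_pM; rewrite ?exprn_ge0 ?l2norm_ge0//.
    have -> : 8^-1 = 2^-1 ^+ 3 :> R by field.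
    by rewrite lerXn2r ?nnegrE ?l2norm_ge0.
  by apply: ES; [exact: sparseZ|exact: l2norm_normalized].
have := FB v w; lra.
Qed.

Lemma cubic_moment_sparse (u : 'cV[R]_p) : sparse q u ->
  F u <= 64 * M * n%:R * l2norm u ^+ 3.
Proof.
move=> su; have [->|u0] := eqVneq u 0.
  rewrite -(scale0r 0) FZ normr0 expr0n mul0r.
  by rewrite mulr_ge0 ?exprn_ge0 ?l2norm_ge0// !mulr_ge0.
rewrite {1}(unit_scale u0) FZ ger0_norm ?l2norm_ge0// mulrC.
rewrite ler_wpM2r ?exprn_ge0 ?l2norm_ge0//.
by apply: cubic_moment_unit; [exact: sparseZ|exact: l2norm_normalized].
Qed.

(** The error must be small against the main term: [G w >= a n / 16] at the grid point [w], while
    the condition on [m] and the cubic bound give [G (u - w) <= a n / 64]. Then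
    [G w <= 2 G u + 2 G (u - w)] leaves [a n / 64]. *)
Lemma quadratic_moment_sparse (u : 'cV[R]_p) :
  64 * (1 + 64 * M) <= a * m%:R ^+ 2 ->
  sparse q u -> a / 64 * n%:R * l2norm u ^+ 2 <= G u.
Proof.
move=> ha su; have [->|u0] := eqVneq u 0.
  by rewrite l2norm0 expr0n mulr0 sumr_ge0// => i _; exact: sqr_ge0.
rewrite [in leRHS](unit_scale u0) GZ [leLHS]mulrC.
rewrite ler_wpM2l ?sqr_ge0//.
have : sparse q ((l2norm u)^-1 *: u) by exact: sparseZ.
have := l2norm_normalized u0.
move: (_ *: u) => {u su u0}u u1 su.
have [z [sz hz /andP[z1 z2] _]] := approx su u1.
set w := grid_point z in sz z1 z2 hz.
have w0 := v_neq0 z1.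
have n0 : (0 : R) <= n%:R by [].
have Gw : 4^-1 * (a / 4 * n%:R) <= G w.
  rewrite (unit_scale w0) GZ.
  apply: ler_pM; rewrite ?gridG ?mulr_ge0 ?divr_ge0 ?(ltW a0)//.
  have -> : 4^-1 = 2^-1 ^+ 2 :> R by field.
  by rewrite lerXn2r // ?nnegrE ?l2norm_ge0.
have m0 : 0 < m%:R ^+ 2 :> R by rewrite exprn_gt0// ltr0n ltnW.
have Guw : G (u - w) <= a / 64 * n%:R.
  have [->|uw0] := eqVneq (u - w) 0.
    by rewrite -(scale0r 0) GZ expr0n mul0r mulr_ge0 ?divr_ge0 ?(ltW a0).
  rewrite (unit_scale uw0) GZ.
  apply: (@le_trans _ _ (m%:R ^- 2 * ((1 + 64 * M) * n%:R))).
    apply: ler_pM; rewrite ?sqr_ge0//.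
      by apply: sumr_ge0 => i _; exact: sqr_ge0.
    apply: (le_trans (GF _)); rewrite mulrDl mul1r lerD2l.
    by apply: cubic_moment_unit; [exact: sparseZ|exact: l2norm_normalized].
  rewrite mulrA ler_wpM2r// mulrC ler_pdivrMr//.
  have := ha; lra.
have := GB u w; lra.
Qed.

End grid_to_sphere.

(** * Moment bounds in finitely many directions, with high probability *)

Section moment_event.
Context (R : realType) (n p q : nat) (a1 a2 a3 : R).
Hypotheses (q0 : (0 < q)%N) (a3_gt0 : 0 < a3).
Context d (T : measurableType d) (P : probability T R).
Variables (X : 'I_n -> {RV P >-> p.-tuple R}) (i0 : 'I_n).
Hypothesis iidX : iid X.
Hypothesis second_moment : forall u : 'cV[R]_p, sparse q u -> l2norm u = 1 ->
  (a1%:E <= \int[P]_w (dotv (vec_of_tuple (X i0 w)) u ^+ 2)%:E)%E.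
Hypothesis third_moment : forall u : 'cV[R]_p, sparse q u -> l2norm u = 1 ->
  (\int[P]_w (`|dotv (vec_of_tuple (X i0 w)) u| ^+ 3)%:E <= a2%:E)%E.
Hypothesis bounded : forall j : 'I_p,
  {ae P, forall w, `|vec_of_tuple (X i0 w) j 0| <= a3}.

Lemma dotv_sparse_le (x u : 'cV[R]_p) : (forall j, `|x j 0| <= a3) ->
  sparse q u -> l2norm u = 1 -> `|dotv x u| <= a3 * Num.sqrt q%:R.
Proof.
move=> xa su u1; set s := Num.sqrt _.
have qR : 0 < q%:R :> R by rewrite ltr0n.
have s0 : 0 < s by rewrite sqrtr_gt0.
have s2 : s ^+ 2 = q%:R by rewrite sqr_sqrtr// ltW.
rewrite dotvE; apply: le_trans (ler_norm_sum _ _ _) _.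
(* AM-GM on the support: 2 |u_j| <= 1 / s + s u_j^2 *)
apply: (@le_trans _ _ (\sum_j a3 * ((u j 0 != 0)%:R / s + s * u j 0 ^+ 2) / 2)).
  apply: ler_sum => j _; rewrite normrM -mulrA.
  apply: ler_pM => //.
  have [->|uj] := eqVneq (u j 0) 0.
    by rewrite normr0 expr0n !(mul0r, mulr0) addr0 mul0r.
  rewrite -[u j 0 ^+ 2]real_normK ?num_real//=.
  move: `|_| (normr_ge0 (u j 0)) => t t0.
  rewrite -subr_ge0 (_ : _ - _ = s / 2 * (s^-1 - t) ^+ 2).
    by rewrite mulr_ge0 ?sqr_ge0// divr_ge0// ltW.
  by field; rewrite gt_eqF.
rewrite -mulr_suml -mulr_sumr -mulrA ler_pM2l// big_split/=.
rewrite -mulr_suml -mulr_sumr.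
rewrite -sqr_l2norm u1 expr1n mulr1 ler_pdivrMr//.
have cardR : \sum_j (u j 0 != 0)%:R <= s ^+ 2.
  by rewrite s2 -natr_sum ler_nat -big_mkcond/= sum1_card.
have : (\sum_j (u j 0 != 0)%:R) / s <= s.
  by rewrite ler_pdivrMr// -expr2.
lra.
Qed.

Let cube := [set x : p.-tuple R | forall j, `|tnth x j| <= a3].

Let measurable_cube : measurable cube.
Proof.
have -> : cube = \bigcap_(j in [set: 'I_p])
    ((fun x : p.-tuple R => `|tnth x j|) @^-1` `]-oo, a3]%classic).
  apply/seteqP; split=> x /=; first by move=> h j _ /=; rewrite in_itv/=.
  by move=> h j; have /= := h j I; rewrite in_itv.
apply: fin_bigcap_measurable; first exact: finite_finset.
move=> j _; rewrite -[_ @^-1` _]setTI.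
have h : measurable_fun setT (fun x : p.-tuple R => `|tnth x j|).
  by apply: measurableT_comp => //; exact: measurable_tnth.
exact: h.
Qed.

Let measurable_dotv (u : 'cV[R]_p) :
  measurable_fun setT (fun x : p.-tuple R => dotv (vec_of_tuple x) u).
Proof.
have -> : (fun x : p.-tuple R => dotv (vec_of_tuple x) u) =
    (fun x => \sum_j tnth x j * u j 0).
  by apply/funext => x; rewrite dotvE; apply: eq_bigr => j _; rewrite mxE.
apply: measurable_sum => j; apply: measurable_funM => //.
exact: measurable_tnth.
Qed.

(** Almost sure boundedness is assumed at the index [i0]; equality of distributions carries it to
    every [i]. *)
Let prob_cube i : P (X i @^-1` (~` cube)) = 0%E.
Proof.
have mC : measurable (~` cube) by exact: measurableC.
have -> : P (X i @^-1` ~` cube) = P (X i0 @^-1` ~` cube).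
  exact: (iidX.2 i i0).
apply/negligibleP; first by rewrite -[_ @^-1` _]setTI; exact: measurable_funP.
have : {ae P, forall w, forall j, `|vec_of_tuple (X i0 w) j 0| <= a3}.
  by apply: filter_forall => j; exact: bounded.
apply: negligibleS => w /= h h'; apply: h => j.
by have := h' j; rewrite mxE.
Qed.

(** Truncation by [cube] turns the almost sure bound into a pointwise one, as the Chernoff bounds
    require. *)
Let Y k (u : 'cV[R]_p) (x : p.-tuple R) : R :=
  `|dotv (vec_of_tuple x) u| ^+ k * \1_cube x.

Let mY k u : measurable_fun setT (Y k u).
Proof.
apply: measurable_funM; last exact: measurable_indic.
by apply: measurable_funX; exact: measurableT_comp.
Qed.

(* q >= 1 lets the powers s^2 and s^3 of s = sqrt q be replaced by q^2 = s^4. *)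
Let Y_bounds k u x : (k <= 4)%N -> sparse q u -> l2norm u = 1 ->
  0 <= Y k u x <= a3 ^+ k * q%:R ^+ 2.
Proof.
move=> k4 su u1; rewrite /Y mulr_ge0 ?exprn_ge0//=.
have [xC|xC] := pselect (cube x); last first.
  by rewrite indicE memNset// mulr0 mulr_ge0 ?exprn_ge0// ltW.
rewrite indicE mem_set// mulr1.
have h : `|dotv (vec_of_tuple x) u| <= a3 * Num.sqrt q%:R.
  by apply: dotv_sparse_le => // j; rewrite mxE; exact: xC.
apply: (@le_trans _ _ ((a3 * Num.sqrt q%:R) ^+ k)).
  by rewrite lerXn2r// ?nnegrE mulr_ge0 ?sqrtr_ge0// ltW.
rewrite exprMn ler_wpM2l ?exprn_ge0 ?(ltW a3_gt0)//.
rewrite -[X in X ^+ 2](@sqr_sqrtr _ q%:R)// -exprM.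
by apply: ler_weXn2l => //; rewrite -[leLHS]sqrtr1 ler_wsqrtr// ler1n.
Qed.

(** Truncation changes the integrand on a null set only, so the lower bound survives. For the third
    moment it can only decrease the integrand. *)
Let Y_second u : sparse q u -> l2norm u = 1 ->
  (a1%:E <= \int[P]_w (Y 2 u (X i0 w))%:E)%E.
Proof.
move=> su u1; apply: le_trans (second_moment su u1) _.
apply: ae_ge0_le_integral => //=.
- by move=> w _; rewrite lee_fin sqr_ge0.
- apply/measurable_EFinP; apply: measurable_funX.
  exact: (measurableT_comp (measurable_dotv u)).
- by move=> w _; rewrite lee_fin mulr_ge0 ?exprn_ge0.
- by apply/measurable_EFinP; exact: (measurableT_comp (mY 2 u)).
- exists (X i0 @^-1` ~` cube); split.
  + rewrite -[_ @^-1` _]setTI.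
    by apply: measurable_funP => //; exact: measurableC.
  + exact: prob_cube.
  + move=> w /= h xC; apply: h => _.
    by rewrite lee_fin /Y indicE mem_set// mulr1 real_normK ?num_real.
Qed.

Let Y_third u : sparse q u -> l2norm u = 1 ->
  (\int[P]_w (Y 3 u (X i0 w))%:E <= a2%:E)%E.
Proof.
move=> su u1; apply: le_trans (third_moment su u1).
apply: ge0_le_integral => //=.
- by move=> w _; rewrite lee_fin mulr_ge0 ?exprn_ge0.
- by apply/measurable_EFinP; exact: (measurableT_comp (mY 3 u)).
- apply/measurable_EFinP; apply: measurable_funX; apply: measurableT_comp => //.
  exact: (measurableT_comp (measurable_dotv u)).
- by move=> w _; rewrite lee_fin ler_piMr ?exprn_ge0// indicE lern1 leq_b1.
Qed.

(** The exceptional event joins the null events [N i] and two Chernoff events for each [z]. The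
    bounds [a3^k q^2] of [Y_bounds] and the conditions on [r] give each of the latter probability at
    most [exp (- r n / q^2)]. *)
Lemma moment_event (S : finType) (v : S -> 'cV[R]_p) (r : R) :
  (forall z, sparse q (v z)) -> (forall z, l2norm (v z) = 1) ->
  r <= (2 * a3 ^+ 3)^-1 -> r <= a1 / (4 * a3 ^+ 2) ->
  exists E : set T, [/\ measurable E,
    (forall w, E w -> forall z,
      \sum_i `|dotv (vec_of_tuple (X i w)) (v z)| ^+ 3 <= (2 * a2 + 1) * n%:R /\
      a1 / 4 * n%:R <= \sum_i dotv (vec_of_tuple (X i w)) (v z) ^+ 2) &
    ((1 - #|S|%:R * 2 * expR (- (r * n%:R / q%:R ^+ 2)))%:E <= P E)%E].
Proof.
move=> sv v1 r3 r2.
have qR : 0 < q%:R ^+ 2 :> R by rewrite exprn_gt0// ltr0n.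
pose A z := [set w | (n%:R * (2 * a2 + 1) <= \sum_i Y 3 (v z) (X i w))%R].
pose L z := [set w | (\sum_i Y 2 (v z) (X i w) <= n%:R * (a1 / 4))%R].
pose N i := X i @^-1` ~` cube.
have mN i : measurable (N i).
  rewrite /N -[_ @^-1` _]setTI.
  by apply: measurable_funP => //; exact: measurableC.
have mS k z : measurable_fun setT (fun w => \sum_i Y k (v z) (X i w)).
  by apply: measurable_sum => i; exact: (measurableT_comp (mY k (v z))).
have mA z : measurable (A z).
  have -> : A z = (fun w => \sum_i Y 3 (v z) (X i w)) @^-1`
      `[n%:R * (2 * a2 + 1), +oo[%classic.
    by apply/seteqP; split=> w /=; rewrite in_itv/= andbT.
  by rewrite -[_ @^-1` _]setTI; exact: mS.
have mL z : measurable (L z).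
  have -> : L z = (fun w => \sum_i Y 2 (v z) (X i w)) @^-1`
      `]-oo, n%:R * (a1 / 4)]%classic.
    by apply/seteqP; split=> w /=; rewrite in_itv/=.
  by rewrite -[_ @^-1` _]setTI; exact: mS.
pose e := expR (- (r * n%:R / q%:R ^+ 2)).
have B3 : 0 < a3 ^+ 3 * q%:R ^+ 2 by rewrite mulr_gt0// exprn_gt0.
have B2 : 0 < a3 ^+ 2 * q%:R ^+ 2 by rewrite mulr_gt0// exprn_gt0.
have PA z : (P (A z) <= e%:E)%E.
  have := chernoff_upper iidX (mY 3 (v z)) B3
    (fun x => @Y_bounds 3 (v z) x isT (sv z) (v1 z)) (Y_third (sv z) (v1 z)).
  rewrite card_ord => /le_trans; apply; rewrite lee_fin ler_expR lerN2.
  rewrite (_ : _ / (2 * _) = (2 * a3 ^+ 3)^-1 * n%:R / q%:R ^+ 2).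
    by rewrite ler_wpM2r ?invr_ge0 ?(ltW qR)// ler_wpM2r.
  by field; rewrite !gt_eqF// ltr0n.
have PL z : (P (L z) <= e%:E)%E.
  have := chernoff_lower iidX (mY 2 (v z)) B2
    (fun x => @Y_bounds 2 (v z) x isT (sv z) (v1 z)) (Y_second (sv z) (v1 z)).
  rewrite card_ord => /le_trans; apply; rewrite lee_fin ler_expR lerN2.
  rewrite (_ : _ / (4 * _) = a1 / (4 * a3 ^+ 2) * n%:R / q%:R ^+ 2).
    by rewrite ler_wpM2r ?invr_ge0 ?(ltW qR)// ler_wpM2r.
  by field; rewrite !gt_eqF// ltr0n.
pose U := (\big[setU/set0]_i N i) `|` (\big[setU/set0]_z (A z `|` L z)).
have mU1 : measurable (\big[setU/set0]_i N i) by exact: bigsetU_measurable.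
have mU2 : measurable (\big[setU/set0]_z (A z `|` L z)).
  by apply: bigsetU_measurable => z _; exact: measurableU.
have mU : measurable U by exact: measurableU.
exists (~` U); split; first exact: measurableC.
- move=> w Uw z.
  have Cw i : cube (X i w).
    by apply: contrapT => Ci; apply: Uw; left;
      exact: (@subset_bigsetU _ _ _ xpredT N i).
  have YE k : \sum_i Y k (v z) (X i w) =
      \sum_i `|dotv (vec_of_tuple (X i w)) (v z)| ^+ k.
    by apply: eq_bigr => i _; rewrite /Y indicE mem_set// mulr1.
  have Aw : ~ (A z `|` L z) w.
    move=> h; apply: Uw; right.
    exact: (@subset_bigsetU _ _ _ xpredT (fun z => A z `|` L z) z).
  split.
    rewrite mulrC leNgt; apply/negP => h; apply: Aw; left.
    by rewrite /A/= YE ltW.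
  rewrite leNgt; apply/negP => h; apply: Aw; right.
  rewrite /L/= YE mulrC; apply: ltW; apply: le_lt_trans h.
  by apply: ler_sum => i _; rewrite real_normK ?num_real.
- rewrite probability_setC// EFinB leeB//.
  apply: (le_trans (measureU2 _ mU1 mU2)).
  rewrite -[leRHS]add0e; apply: leeD.
    apply: le_trans (measure_bigsetU_le _ _ _ mN) _.
    by rewrite big1// => i _; exact: prob_cube.
  apply: le_trans (measure_bigsetU_le _ _ _ _) _.
    by move=> z; exact: measurableU.
  rewrite (_ : _ * _ * _ = \sum_(z : S) 2 * e); last first.
    by rewrite sumr_const -[RHS]mulr_natl mulrA.
  rewrite -sumEFin; apply: lee_sum => z _.
  apply: le_trans (measureU2 _ _ _) _ => //.
  rewrite mulr_natl mulr2n EFinD; exact: (leeD (PA z) (PL z)).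
Qed.

End moment_event.

(** * Counting the grid and choosing the constants *)

Lemma grid_union_bound (R : realType) (n p q m : nat) (r : R) :
  (1 < p)%N -> (0 < q)%N -> (q <= p)%N -> (0 < m)%N -> 0 < r ->
  2 * (3 * m + 3)%:R / r * q%:R ^+ 3 * ln p%:R <= n%:R ->
  (p ^ q * (2 * (m * q)).+1 ^ q)%:R * 2 * expR (- (r * n%:R / q%:R ^+ 2)) <=
    expR (- (r / 2 * n%:R / q%:R ^+ 3)).
Proof.
move=> p1 q0 qp m0 r0 hn.
(* [2 m q + 1 <= 3 m p <= p^(3 m + 1)], by [q <= p] and [3 m < 2^(3 m)]. The last factor [p^q]
   absorbs the 2. *)
have card : (p ^ q * (2 * (m * q)).+1 ^ q * 2 <= p ^ (q * (3 * m + 3)))%N.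
  have h : ((2 * (m * q)).+1 <= p ^ (3 * m + 1))%N.
    have mq : (0 < m * q)%N by rewrite muln_gt0 m0.
    apply: (@leq_trans (3 * m * p)); last first.
      rewrite addn1 expnSr leq_mul2r; apply/orP; right.
      apply: ltnW; apply: (leq_trans (ltn_expl (3 * m) (isT : 1 < 2)%N)).
      by rewrite leq_exp2r// muln_gt0.
    apply: (@leq_trans (3 * (m * q))); last first.
      by rewrite -mulnA leq_mul2l leq_mul2l qp !orbT.
    by rewrite (_ : 3 = 2 + 1)%N// mulnDl mul1n -addn1 leq_add2l.
  have -> : (q * (3 * m + 3) = q + (3 * m + 1) * q + q)%N by ring.
  rewrite !expnD; apply: leq_mul.
    by apply: leq_mul => //; rewrite expnM leq_exp2r.
  by apply: (leq_trans p1); rewrite -[leqLHS]expn1 leq_pexp2l// ltnW.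
have pR : 0 < p%:R :> R by rewrite ltr0n ltnW.
have qR : 0 < q%:R :> R by rewrite ltr0n.
have lnp : 0 < ln p%:R :> R by rewrite ln_gt0// ltr1n.
apply: (@le_trans _ _ (expR ((q * (3 * m + 3))%:R * ln p%:R) *
    expR (- (r * n%:R / q%:R ^+ 2)))).
  rewrite ler_wpM2r ?expR_ge0// -natrM expRM_natl lnK ?posrE// -natrX ler_nat.
  exact: card.
rewrite -expRD ler_expR.
set N : R := n%:R in hn *; set Q : R := q%:R in hn qR *.
set L := ln _ in hn lnp *; rewrite natrM -/Q.
set c : R := (_ + _)%:R in hn *.
have Q1 : 1 <= Q by rewrite ler1n.
have N0 : 0 <= N by [].
(* The sample size makes the logarithm of the count at most half of the exponent; the other half
   remains, weakened from [q^2] to [q^3]. *)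
have h1 : Q * c * L <= r / 2 * N / Q ^+ 2.
  rewrite ler_pdivlMr ?exprn_gt0//.
  have -> : Q * c * L * Q ^+ 2 = r / 2 * (2 * c / r * Q ^+ 3 * L).
    by field; rewrite gt_eqF.
  by rewrite ler_wpM2l// divr_ge0// ltW.
have h2 : r / 2 * N / Q ^+ 3 <= r / 2 * N / Q ^+ 2.
  rewrite ler_wpM2l//; first by rewrite mulr_ge0// divr_ge0// ltW.
  by rewrite lef_pV2 ?posrE ?exprn_gt0// ler_weXn2l.
have -> : r * N / Q ^+ 2 = r / 2 * N / Q ^+ 2 + r / 2 * N / Q ^+ 2.
  by field; rewrite gt_eqF.
lra.
Qed.

Lemma sparse_minn (R : realType) (p q : nat) (u : 'cV[R]_p) :
  sparse (minn q p) u -> sparse q u.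
Proof. by move/leq_trans; apply; rewrite geq_minl. Qed.

Theorem theorem2p1 (R : realType) (a1 a2 a3 : R)
    (ha1 : 0 < a1) (ha2 : 0 < a2) (ha3 : 0 < a3) :
  exists (c_sample c_change c_prob : R) (c_lower c_upper : R -> R),
    [/\ 0 < c_sample, 0 < c_change & 0 < c_prob] /\
    [/\ (forall t, 0 <= t -> 0 < c_lower t),
        {in `[0, +oo[ &, decreasing_fun c_lower},
        (forall t, 0 <= t -> 0 < c_upper t) &
        {in `[0, +oo[ &, increasing_fun c_upper}] /\
    forall (n p q : nat) (hn : (1 < n)%N) (hp : (1 < p)%N) (hq : (0 < q)%N)
      (d : measure_display) (T : measurableType d) (P : probability T R)
      (X : 'I_n -> {RV P >-> p.-tuple R}),
      let X1 := fun w => vec_of_tuple (X (Ordinal (ltnW hn)) w) in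
      iid X ->
      (forall u : 'cV[R]_p, sparse q u -> l2norm u = 1 ->
        (a1%:E <= 'E_P[fun w => (dotv (X1 w) u ^+ 2)%R])%E) ->
      (forall u : 'cV[R]_p, sparse q u -> l2norm u = 1 ->
        ('E_P[fun w => (`|dotv (X1 w) u| ^+ 3)%R] <= a2%:E)%E) ->
      (forall j : 'I_p, {ae P, forall w, `|X1 w j 0| <= a3}) ->
      c_sample * q%:R ^+ 3 * ln p%:R <= n%:R ->
      with_prob_ge P (1 - expR (- (c_prob * n%:R / q%:R ^+ 3)))
        (fun w =>
          let H := fun J : {set 'I_p} =>
            neg_hessian_sub (fun i => vec_of_tuple (X i w)) (J := J) in
          forall J : {set 'I_p}, (#|J| <= q)%N ->
          forall b b' : 'cV[R]_#|J|,
            [/\ loewner_le (c_lower (l2norm b))%:M (n%:R^-1 *: H J b),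
                loewner_le (n%:R^-1 *: H J b) (c_upper (l2norm b))%:M &
                n%:R^-1 * spectral_norm (H J b - H J b')
                  <= c_change * l2norm (b - b')]).
Proof.
(* [M] is the threshold in [moment_event]; [M'] and [kappa] are the constants of
   [cubic_moment_sparse] and [quadratic_moment_sparse]. *)
pose M : R := 2 * a2 + 1; pose M' := 64 * M; pose kappa := a1 / 64.
(* This gives [a1 m >= 64 (1 + M')], and the double successor ensures [m >= 2] for the passage from
   the grid to the sphere. *)
pose m := (Num.truncn (64 * (1 + M') / a1)).+2.
(* The smaller of the rates of the upper and the lower tail. *)
pose r := Num.min (2 * a3 ^+ 3)^-1 (a1 / (4 * a3 ^+ 2)).
have M0 : 0 < M by rewrite /M; lra.
have M'0 : 0 < M' by rewrite /M' mulr_gt0.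
have kappa0 : 0 < kappa by rewrite divr_gt0.
have r0 : 0 < r.
  by rewrite lt_min invr_gt0 divr_gt0 ?mulr_gt0 ?exprn_gt0.
have hm : 64 * (1 + 64 * M) <= a1 * m%:R ^+ 2.
  have x0 : 0 <= 64 * (1 + M') / a1.
    by rewrite divr_ge0 ?mulr_ge0 ?addr_ge0// ltW.
  have /andP[_ h] := truncn_itv x0.
  rewrite -ler_pdivrMl// mulrC; apply: (le_trans (ltW h)).
  rewrite -natrX ler_nat (@leq_trans m)// expnS expn1 leq_pmulr//.
exists (2 * (3 * m + 3)%:R / r), M', (r / 2),
  (fun t => kappa / 4 * expR (- (M' / kappa * t))), (fun t => 1 + M' + t).
split.
  split=> //; last by rewrite divr_gt0.
  by rewrite divr_gt0// mulr_gt0// ltr0n addn_gt0 orbT.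
split.
  split.
  - by move=> t _; rewrite mulr_gt0 ?expR_gt0// divr_gt0.
  - move=> s t _ _.
    by rewrite ler_pM2l ?divr_gt0// ler_expR lerN2 ler_pM2l ?divr_gt0.
  - by move=> t t0; rewrite ltr_wpDr// addr_gt0.
  - by move=> s t _ _; rewrite lerD2l.
move=> n p q hn hp hq d T P X X1 iidX h2 h3 hb hN.
have n0 : (0 < n)%N by exact: ltnW.
have p0 : (0 < p)%N by exact: ltnW.
(* The count in [grid_union_bound] asks for sparsity at most [p]. Passing to [k] is harmless: every
   [J] has at most [p] elements, and [k <= q] preserves the moment hypotheses, the sample size
   condition and the probability bound. *)
pose k := minn q p.
have k0 : (0 < k)%N by rewrite leq_min hq.
have kp : (k <= p)%N by exact: geq_minr.
have kR : k%:R ^+ 3 <= q%:R ^+ 3 :> R.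
  by rewrite lerXn2r ?nnegrE// ler_nat geq_minl.
have kR0 : 0 < k%:R ^+ 3 :> R by rewrite exprn_gt0// ltr0n.
have lnp : 0 < ln p%:R :> R by rewrite ln_gt0// ltr1n.
have hNk : 2 * (3 * m + 3)%:R / r * k%:R ^+ 3 * ln p%:R <= n%:R.
  apply: le_trans hN; rewrite ler_wpM2r ?(ltW lnp)// ler_wpM2l//.
  by rewrite divr_ge0 ?mulr_ge0// ltW.
(* A zero grid point has no direction and is left out. *)
pose S := {z : grid_index p k m | grid_point z != 0 :> 'cV[R]_p}.
pose v (z : S) : 'cV[R]_p :=
  (l2norm (grid_point (val z) : 'cV[R]_p))^-1 *: grid_point (val z).
have [|||||||E [mE hE PE]] := @moment_event R n p k a1 a2 a3 k0 ha3 d T P X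
    (Ordinal (ltnW hn)) iidX _ _ _ S v r.
- by move=> u su u1; have := h2 u (sparse_minn su) u1; rewrite unlock.
- by move=> u su u1; have := h3 u (sparse_minn su) u1; rewrite unlock.
- exact: hb.
- by move=> z; apply: sparseZ; exact: sparse_grid_point.
- by move=> z; apply: l2norm_normalized; exact: (valP z).
- by rewrite ge_min lexx.
- by rewrite ge_min lexx orbT.
exists E; split=> //; last first.
  apply: le_trans PE; rewrite lee_fin lerD2l lerN2.
  apply: (@le_trans _ _ (expR (- (r / 2 * n%:R / k%:R ^+ 3)))); last first.
    rewrite ler_expR lerN2 ler_wpM2l ?mulr_ge0 ?divr_ge0 ?(ltW r0)//.
    by rewrite lef_pV2 ?posrE// (lt_le_trans kR0).
  apply: le_trans (grid_union_bound hp k0 kp (isT : 0 < m)%N r0 hNk).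
  rewrite ler_wpM2r ?expR_ge0// ler_wpM2r// ler_nat -card_grid_index.
  by rewrite card_sig max_card.
move=> w Ew H J Jq b b'.
have Jk : (#|J| <= k)%N.
  by rewrite leq_min Jq/= -[leqRHS]card_ord max_card.
pose Xw i := vec_of_tuple (X i w).
have gF (z : grid_index p k m) : grid_point z != 0 :> 'cV[R]_p ->
    \sum_i `|dotv (Xw i) ((l2norm (grid_point z))^-1 *: grid_point z)| ^+ 3 <=
      M * n%:R.
  by move=> z0; have [] := hE w Ew (exist _ z z0).
have gG (z : grid_index p k m) : grid_point z != 0 :> 'cV[R]_p ->
    a1 / 4 * n%:R <=
      \sum_i dotv (Xw i) ((l2norm (grid_point z))^-1 *: grid_point z) ^+ 2.
  by move=> z0; have [] := hE w Ew (exist _ z z0).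
apply: (hessian_bounds n0 kappa0 M'0 _ _ Jk) => u su.
  apply: (@quadratic_moment_sparse R n p k m Xw a1 M) => //; exact: ltW.
by apply: (@cubic_moment_sparse R n p k m Xw M) => //; exact: ltW.
Qed.
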